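(* Let $d \in \mathbb{N}$ and let $(G_n)_{n\ge 1}$ be a sequence of finite simple graphs with all vertex degrees at most $d$. If $(G_n)$ is weakly convergent and the family $\{G_n\}_{n\ge1}$ is hyperfinite, then $(G_n)$ is strongly convergent.
   Context: All graphs are finite, simple (no loops, no multiple edges), with vertex degree bounded by $d$; $\mathcal{G}_d$ denotes this class. For a graph $G$, $d_G$ is the shortest-path metric, and for $x \in V(G)$ and $r \in \mathbb{N}$, $B_r^G(x)$ is the subgraph induced by $G$ on $\{y : d_G(x,y)\le r\}$, rooted at $x$. Two rooted graphs are rooted isomorphic if there is a graph isomorphism between them mapping root to root. For a rooted isomorphism class $\alpha$ of radius $r$ (i.e. $r$ is the least integer with all vertices within distance $r$ of the root), let $p(G,\alpha)$ be the proportion of vertices $x \in V(G)$ with $B_r^G(x)$ rooted isomorphic to $\alpha$. Weak convergence: $(G_n)$ is weakly convergent if for every $r\in\mathbb{N}$ and every rooted isomorphism class $\alpha$ of radius $r$ with degrees at most $d$, the limit $\lim_{n\to\infty} p(G_n,\alpha)$ exists. Hyperfiniteness: a family $\mathcal{P}\subseteq\mathcal{G}_d$ is hyperfinite if for every $\varepsilon>0$ there is $K_\varepsilon\in\mathbb{N}$ such that from every $G\in\mathcal{P}$ one can remove fewer than $\varepsilon|E(G)|$ edges so that every connected component of the resulting graph has at most $K_\varepsilon$ vertices. Geometric distance: if $G,H$ are graphs on the same vertex set $V$ (vertices labeled $1,\dots,|V|$), let $\delta(G,H)$ be the proportion of $v\in V$ whose star (the $1$-ball around $v$, including the labels of its vertices,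 i.e. the set of neighbours of $v$) differs in $G$ and $H$. Let $\delta_S(G,H)=\min_{\sigma} \delta(G,H^\sigma)$, the minimum over all permutations $\sigma$ of $V$, with $H^\sigma$ the graph obtained by relabeling the vertices of $H$ by $\sigma$ (graphs with the same number of vertices are compared by identifying their vertex sets by any bijection). For arbitrary $G,H$, set $\delta_\rho(G,H)=\inf\{\delta_S(qG,pH) : p,q\in\mathbb{N},\ q|V(G)|=p|V(H)|\}$, where $qG$ is the disjoint union of $q$ copies of $G$; by convention $\delta=1$ between a graph and the empty graph. $\delta_\rho$ is a metric on isomorphism classes of such finite graphs. Strong convergence: $(G_n)$ is strongly convergent if the sequence of isomorphism classes of $G_n$ is a Cauchy sequence with respect to $\delta_\rho$. *)

(* Defs.v *)
From mathcomp Require Import all_boot all_order all_algebra.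
From mathcomp Require Import all_classical all_reals all_analysis.
Set Implicit Arguments.
Unset Strict Implicit.
Unset Printing Implicit Defensive.
Import Order.TTheory GRing.Theory Num.Theory.
Import numFieldNormedType.Exports.
Local Open Scope classical_set_scope.
Local Open Scope ring_scope.

Record sgraph_on (V : finType) := SGraphOn {
  adj : rel V;
  adj_sym : symmetric adj;
  adj_irr : irreflexive adj }.

Record sgraph := SGraph {
  vert :> finType;
  sgraph_struct :> sgraph_on vert }.

Definition nbr (V : finType) (G : sgraph_on V) (x : V) : {set V} :=
  [set y | adj G x y]%SET.

Definition max_degree (d : nat) (G : sgraph) : Prop :=
  forall x : G, (#|nbr G x| <= d)%N.

Section Pullback.
Variables (V W : finType) (f : V -> W) (H : sgraph_on W).
Let e : rel V := fun x y => adj H (f x) (f y).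
Fact pullback_sym : symmetric e. Proof. by move=> x y; apply: adj_sym. Qed.
Fact pullback_irr : irreflexive e. Proof. by move=> x; apply: adj_irr. Qed.
Definition pullback : sgraph_on V := SGraphOn pullback_sym pullback_irr.
End Pullback.

Definition induced (G : sgraph) (S : {set G}) : sgraph :=
  SGraph (pullback (fun u : {y : G | y \in S} => val u) G).

Definition has_walk (G : sgraph) (x y : G) (k : nat) : bool :=
  [exists t : k.-tuple G, path (adj G) x t && (last x t == y)].

(* [None] stands for an infinite distance; a shortest walk visits pairwise
   distinct vertices, so its length is less than [#|G|]. *)
Definition gdist (G : sgraph) (x y : G) : option nat :=
  ohead [seq k <- iota 0 #|G| | has_walk x y k].

Definition gdist_le (G : sgraph) (x y : G) (r : nat) : bool :=
  if gdist x y is Some k then (k <= r)%N else false.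

Record rgraph := RGraph {
  rg_graph :> sgraph;
  rg_root : rg_graph }.

Definition ball_set (G : sgraph) (x : G) (r : nat) : {set G} :=
  [set y | gdist_le x y r]%SET.

Lemma gdist_leP (G : sgraph) (x y : G) (r : nat) :
  reflect (exists2 s, path (adj G) x s & last x s = y /\ (size s <= r)%N)
          (gdist_le x y r).
Proof.
have walkP k : reflect (exists2 s, path (adj G) x s & last x s = y /\ size s = k)
                       (has_walk x y k).
  apply: (iffP existsP) => [[t /andP[pt /eqP lt]]|[s ps [ls ss]]].
    by exists (val t) => //; rewrite size_tuple.
  have/eqP ss' := ss; exists (Tuple ss') => /=.
  by rewrite ps ls eqxx.
rewrite /gdist_le /gdist; apply: (iffP idP).
  case E: [seq _ <- _ | _] => [|k l] //= kr.
  have : k \in [seq k <- iota 0 #|G| | has_walk x y k] by rewrite E mem_head.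
  rewrite mem_filter => /andP[/walkP[s ps [ls ss]] _].
  by exists s => //; rewrite ss.
move=> [s0 ps0 [ls0 ss0]].
have [s [ps ls us ss]] : exists s,
    [/\ path (adj G) x s, last x s = y, uniq (x :: s) & (size s <= r)%N].
  case/shortenP: ps0 ls0 => s ps us sub ls; exists s; split=> //.
  apply: leq_trans ss0; apply: uniq_leq_size; last exact: sub.
  by case/andP: us.
have kin : size s \in [seq k <- iota 0 #|G| | has_walk x y k].
  rewrite mem_filter mem_iota add0n /=; apply/andP; split.
    by apply/walkP; exists s.
  by have /card_uniqP /= <- := us; apply: max_card.
have srt : sorted ltn [seq k <- iota 0 #|G| | has_walk x y k].
  by apply: sorted_filter (iota_ltn_sorted _ _); apply: ltn_trans.
case E: [seq _ <- _ | _] kin srt => [|k l] //=.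
rewrite in_cons => /orP[/eqP<- //|sl] /(order_path_min ltn_trans)/allP/(_ _ sl).
by move=> /ltnW kl; apply: leq_trans kl ss.
Qed.

Lemma root_in_ball (G : sgraph) (x : G) (r : nat) : x \in ball_set x r.
Proof. by rewrite inE; apply/gdist_leP; exists [::]. Qed.

Definition rball (G : sgraph) (x : G) (r : nat) : rgraph :=
  @RGraph (induced (ball_set x r)) (exist _ x (root_in_ball x r)).

Definition rooted_iso (A B : rgraph) : Prop :=
  exists f : A -> B,
    [/\ bijective f,
        forall x y, adj B (f x) (f y) = adj A x y
      & f (rg_root A) = rg_root B].

Definition has_radius (A : rgraph) (r : nat) : Prop :=
  (forall y : A, gdist_le (rg_root A) y r) /\
  (forall s : nat, (forall y : A, gdist_le (rg_root A) y s) -> (r <= s)%N).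

(* Meant for [r] the radius of [A]. *)
Definition ball_freq (R : realType) (G : sgraph) (r : nat) (A : rgraph) : R :=
  #|[set x : G | `[< rooted_iso (rball x r) A >]]%SET|%:R / #|G|%:R.

(* Rooted isomorphism classes are quantified over through representatives. *)
Definition weakly_convergent (R : realType) (d : nat) (G : nat -> sgraph) : Prop :=
  forall (r : nat) (A : rgraph), has_radius A r -> max_degree d A ->
    cvg ((fun n => ball_freq R (G n) r A) @ \oo).

Definition edges (G : sgraph) : {set {set G}} :=
  [set e : {set G} | [exists x, exists y, adj G x y && (e == [set x; y]%SET)]]%SET.

Section RemoveEdges.
Variables (G : sgraph) (F : {set {set G}}).
Let e : rel G := fun x y => adj G x y && ([set x; y]%SET \notin F).
Fact remove_edges_sym : symmetric e.
Proof. by move=> x y; rewrite /e adj_sym finset.setUC. Qed.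
Fact remove_edges_irr : irreflexive e.
Proof. by move=> x; rewrite /e adj_irr. Qed.
Definition remove_edges : sgraph :=
  SGraph (SGraphOn remove_edges_sym remove_edges_irr).
End RemoveEdges.

Definition component (G : sgraph) (x : G) : {set G} :=
  [set y | connect (adj G) x y]%SET.

Definition hyperfinite (R : realType) (P : sgraph -> Prop) : Prop :=
  forall eps : R, 0 < eps -> exists K : nat, forall G : sgraph, P G ->
    exists F : {set {set G}},
      [/\ F \subset edges G,
          #|F|%:R < eps * #|edges G|%:R
        & forall x : remove_edges F, (#|component x| <= K)%N].

Definition delta (R : realType) (V : finType) (G H : sgraph_on V) : R :=
  #|[set v : V | nbr G v != nbr H v]%SET|%:R / #|V|%:R.

(* Meant for [#|G| = #|H|], where injections are the bijections.  The map [g] is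
   the inverse of the relabeling [s], so [pullback g H] is [H^s].  The default
   value [1] does not affect the minimum, since [delta] is at most [1]. *)
Definition deltaS (R : realType) (G H : sgraph) : R :=
  \big[Num.min/1]_(g : {ffun G -> H} | injectiveb g) delta R G (pullback g H).

Section Copies.
Variables (q : nat) (G : sgraph).
Let e : rel ('I_q * G)%type := fun u v => (u.1 == v.1) && adj G u.2 v.2.
Fact copies_sym : symmetric e.
Proof. by move=> u v; rewrite /e eq_sym adj_sym. Qed.
Fact copies_irr : irreflexive e.
Proof. by move=> u; rewrite /e adj_irr andbF. Qed.
Definition copies : sgraph := SGraph (SGraphOn copies_sym copies_irr).
End Copies.

(* The first branch is the convention for a nonempty graph compared with the
   empty one, for which no positive [p] and [q] are admissible. *)
Definition delta_rho (R : realType) (G H : sgraph) : R :=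
  if (#|G| == 0%N) != (#|H| == 0%N) then 1
  else inf [set x : R | exists p q : nat,
    [/\ (0 < p)%N, (0 < q)%N, (q * #|G| = p * #|H|)%N
      & x = deltaS R (copies q G) (copies p H)]].

Definition strongly_convergent (R : realType) (G : nat -> sgraph) : Prop :=
  forall eps : R, 0 < eps -> exists N : nat, forall m n : nat,
    (N <= m)%N -> (N <= n)%N -> delta_rho R (G m) (G n) < eps.

(* Main.v *)
(** Cut [G = G m] into pieces of size at most [K] and then [H = G n] into much
    larger pieces, removing few edges each time.  For a piece of [H] rooted at
    [x], the isomorphisms from the ball [B_r(x)] onto balls of [G] pull the
    partition of [G] back to that piece.  A suitable multiple [p] of all the
    numbers of such isomorphisms makes each of them occur equally often among
    [p] copies of [H], so that no randomness is needed.

    The number of pulled-back cells of each isomorphism type has to be, per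
    vertex, about the same as in [G].  The image of a vertex [y] in [G] is
    distributed with a weight depending only on the type of the image at radius
    [r + L], while that type at radius [r - L] is the type of [y].  Hence it
    suffices that the conditional expectation of the cell type of a vertex of
    [G] hardly changes between these two radii; since the energies of these
    conditional expectations increase with the radius and are bounded, this
    holds for some [r] below a bound depending only on the accuracy.  The type
    frequencies of [G] and [H] at all radii below that bound are close by weak
    convergence.

    Finally, matching cells of equal type between copies of [G] and copies of [H]
    changes few stars. *)
Require Import Defs.
From mathcomp Require Import all_boot all_order all_algebra.
From mathcomp Require Import lra ring.
Set Implicit Arguments.
Unset Strict Implicit.
Unset Printing Implicit Defensive.
Import Order.TTheory GRing.Theory Num.Theory.

(** * Balls *)

Lemma leq_card_bigcup (I V : finType) (A : {pred I}) (F : I -> {set V}) :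
  #|\bigcup_(i in A) F i| <= \sum_(i in A) #|F i|.
Proof.
elim/big_rec2: _ => [|i n S _ IH]; first by rewrite cards0.
by apply: leq_trans (leq_card_setU _ _) _; rewrite leq_add2l.
Qed.

Section Balls.
Variable G : sgraph.
Implicit Types (x y z : G) (r s k : nat).

Lemma in_ballP x r y :
  reflect (exists2 s, path (adj G) x s & last x s = y /\ size s <= r)
          (y \in ball_set x r).
Proof. by rewrite inE; apply: gdist_leP. Qed.

Lemma in_ball0 x y : (y \in ball_set x 0) = (y == x).
Proof.
apply/in_ballP/eqP => [[[|z s] //= _ [<- //]]|->].
by exists [::].
Qed.

Lemma sub_ball x r s : r <= s -> ball_set x r \subset ball_set x s.
Proof.
move=> rs; apply/subsetP => y /in_ballP[p pp [lp sp]].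
by apply/in_ballP; exists p => //; split=> //; apply: leq_trans rs.
Qed.

Lemma mem_ball_trans x y z r s :
  y \in ball_set x r -> z \in ball_set y s -> z \in ball_set x (r + s).
Proof.
move=> /in_ballP[p pp [lp sp]] /in_ballP[p' pp' [lp' sp']].
apply/in_ballP; exists (p ++ p'); first by rewrite cat_path pp lp.
by rewrite last_cat lp size_cat leq_add.
Qed.

Lemma mem_ball1 x y : adj G x y -> y \in ball_set x 1.
Proof. by move=> a; apply/in_ballP; exists [:: y] => //=; rewrite a. Qed.

Lemma mem_ballS x y z r :
  y \in ball_set x r -> adj G y z -> z \in ball_set x r.+1.
Proof. by rewrite -addn1 => yx /mem_ball1; apply: mem_ball_trans. Qed.

Lemma in_ballSP x r y :
  reflect (y = x \/ exists2 z, z \in ball_set x r & adj G z y)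
          (y \in ball_set x r.+1).
Proof.
apply: (iffP idP) => [/in_ballP[p pp [lp sp]]|[->|[z zx zy]]]; last 2 first.
- exact: root_in_ball.
- exact: mem_ballS zy.
case/lastP: p pp lp sp => [|p z]; first by left.
rewrite rcons_path last_rcons size_rcons => /andP[pp pz] <- sp.
by right; exists (last x p) => //; apply/in_ballP; exists p.
Qed.

Lemma mem_ball_sym x y r : (y \in ball_set x r) = (x \in ball_set y r).
Proof.
suff H (u v : G) : v \in ball_set u r -> u \in ball_set v r by apply/idP/idP; apply: H.
elim: r u v => [|r IH] u v; first by rewrite !in_ball0 => /eqP ->.
case/in_ballSP => [->|[z zu zv]]; first exact: root_in_ball.
rewrite -add1n; apply: mem_ball_trans (IH _ _ zu).
by apply: mem_ball1; rewrite adj_sym.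
Qed.

Lemma card_ball d x r : max_degree d G -> #|ball_set x r| <= d.+1 ^ r.
Proof.
move=> dG; elim: r => [|r IH].
  by rewrite (@eq_card1 _ x) // => y; rewrite in_ball0.
have sub : ball_set x r.+1 \subset
    \bigcup_(y in ball_set x r) (y |: nbr G y).
  apply/subsetP => y /in_ballSP[->|[z zx zy]]; apply/bigcupP.
    by exists x; rewrite ?root_in_ball // !inE eqxx.
  by exists z => //; rewrite !inE zy orbT.
apply: leq_trans (subset_leq_card sub) _.
apply: leq_trans (leq_card_bigcup _ _) _.
rewrite expnSr; apply: leq_trans (leq_mul IH (leqnn d.+1)).
rewrite -sum_nat_const leq_sum // => y _.
by rewrite cardsU1 -add1n leq_add ?dG //; case: (_ \notin _).
Qed.

End Balls.

(** * Isomorphism types of balls *)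

(** Only the values of [f] on [S] matter. Stating injectivity through cardinality keeps the notion
    boolean. The unary predicate will mark the root of a ball, or the vertices of a piece with an
    edge leaving it. *)
Definition siso (V W : finType) (S : {set V}) (e : rel V) (u : pred V)
    (S' : {set W}) (e' : rel W) (u' : pred W) (f : V -> W) : bool :=
  [&& #|f @: S| == #|S|, f @: S == S',
      [forall x in S, forall y in S, e' (f x) (f y) == e x y]
    & [forall x in S, u' (f x) == u x]].

Lemma sisoP (V W : finType) (S : {set V}) (e : rel V) (u : pred V)
    (S' : {set W}) (e' : rel W) (u' : pred W)
    (f : V -> W) :
  reflect [/\ {in S &, injective f}, f @: S = S',
              {in S &, forall x y, e' (f x) (f y) = e x y}
            & {in S, forall x, u' (f x) = u x}]
          (siso S e u S' e' u' f).
Proof.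
apply: (iffP and4P) => -[].
  move=> /imset_injP inj /eqP im /forall_inP He /forall_inP Hu; split=> //.
    by move=> x y xS yS; move/forall_inP: (He _ xS) => /(_ _ yS) /eqP.
  by move=> x xS; apply/eqP/Hu.
move=> inj im He Hu; split; [exact/imset_injP|exact/eqP| |].
  by apply/forall_inP => x xS; apply/forall_inP => y yS; apply/eqP/He.
by apply/forall_inP => x xS; apply/eqP/Hu.
Qed.

Lemma siso_sym (V W : finType) (S : {set V}) (e : rel V) (u : pred V)
    (S' : {set W}) (e' : rel W) (u' : pred W) (f : V -> W) x0 :
  x0 \in S -> siso S e u S' e' u' f -> exists g, siso S' e' u' S e u g.
Proof.
move=> x0S; case/sisoP => inj im He Hu.
pose g y := odflt x0 [pick x in S | f x == y].
have gK x : x \in S -> g (f x) = x.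
  move=> xS; rewrite /g; case: pickP => [z /andP[zS /eqP]|/(_ x)]; first exact: inj.
  by rewrite xS eqxx.
have S'P y : y \in S' -> exists2 x, x \in S & y = f x.
  by rewrite -im => /imsetP.
exists g; apply/sisoP; split.
- by move=> _ _ /S'P[x xS ->] /S'P[y yS ->]; rewrite !gK // => ->.
- apply/setP => x; apply/imsetP/idP => [[_ /S'P[z zS ->] ->]|xS].
    by rewrite gK.
  by exists (f x); rewrite ?gK // -im imset_f.
- by move=> _ _ /S'P[x xS ->] /S'P[y yS ->]; rewrite !gK // He.
- by move=> _ /S'P[x xS ->]; rewrite gK // Hu.
Qed.

Lemma siso_comp (U V W : finType) (S : {set U}) (e : rel U) (u : pred U)
    (S' : {set V}) (e' : rel V) (u' : pred V)
    (S'' : {set W}) (e'' : rel W) (u'' : pred W) (f : U -> V) (g : V -> W) :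
  siso S e u S' e' u' f -> siso S' e' u' S'' e'' u'' g ->
  siso S e u S'' e'' u'' (g \o f).
Proof.
move=> /sisoP[inj im He Hu] /sisoP[inj' im' He' Hu'].
have fS x : x \in S -> f x \in S' by move=> xS; rewrite -im imset_f.
apply/sisoP; split.
- by move=> x y xS yS /= /inj' E; apply: inj => //; apply: E; apply: fS.
- by rewrite imset_comp im.
- by move=> x y xS yS /=; rewrite He' ?fS // He.
- by move=> x xS /=; rewrite Hu' ?fS // Hu.
Qed.

Section Codes.
Variable D : nat.

(* The isomorphism class of a subset carrying a binary and a unary relation,
   as a copy of it inside ['I_D.+1] chosen once and for all. *)
Definition gcode : finType :=
  ({set 'I_D.+1} * {set 'I_D.+1 * 'I_D.+1} * {set 'I_D.+1})%type.

Section One.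
Variables (V : finType) (S : {set V}) (e : rel V) (u : pred V).
Implicit Types (c : gcode) (f : {ffun V -> 'I_D.+1}).

Definition is_coding c f : bool :=
  siso S e u c.1.1 (fun i j => (i, j) \in c.1.2) (fun i => i \in c.2) f.

Definition has_code c : bool := [exists f, is_coding c f].

Definition code : gcode := odflt (set0, set0, set0) [pick c | has_code c].

Definition pos : {ffun V -> 'I_D.+1} :=
  odflt [ffun=> ord0] [pick f | is_coding code f].

Lemma siso_pos : #|S| <= D.+1 ->
  siso S e u code.1.1 (fun i j => (i, j) \in code.1.2)
       (fun i => i \in code.2) pos.
Proof.
move=> SD.
have [f0 f0inj] : exists f : {ffun V -> 'I_D.+1}, {in S &, injective f}.
  exists [ffun x => inord (index x (enum S))] => x y xS yS; rewrite !ffunE.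
  have ind z : z \in S -> index z (enum S) < D.+1.
    by move=> zS; apply: leq_trans SD; rewrite cardE index_mem mem_enum.
  move=> /(congr1 val) /=; rewrite !inordK ?ind // => E.
  by move: E; apply: (index_inj x); rewrite mem_enum.
(* The structure transported along [f0] is a code, so [pick] does not fall back on the default
   value. *)
have exc : has_code (f0 @: S,
    [set w | [exists x in S, exists y in S, e x y && (w == (f0 x, f0 y))]],
    f0 @: [set x in S | u x]).
  apply/existsP; exists f0; apply/sisoP; split=> //= [x y xS yS|x xS]; rewrite ?inE.
    apply/idP/idP => [/exists_inP[x' x'S /exists_inP[y' y'S]]|exy].
      by case/andP => exy /eqP[/f0inj -> // /f0inj -> //].
    by apply/exists_inP; exists x => //; apply/exists_inP; exists y; rewrite ?exy ?eqxx.
  apply/imsetP/idP => [[z]|ux]; last by exists x; rewrite ?inE ?xS.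
  by rewrite inE => /andP[zS uz] /f0inj -> //.
have hc : has_code code.
  by rewrite /code; case: pickP => [c //|n0]; rewrite n0 in exc.
rewrite /pos; case: pickP => // n0; case/existsP: hc => f.
by rewrite n0.
Qed.

End One.

Section Two.
Variables (V W : finType) (S : {set V}) (e : rel V) (u : pred V).
Variables (S' : {set W}) (e' : rel W) (u' : pred W).

Lemma has_code_siso (f : V -> W) c :
  siso S e u S' e' u' f -> has_code S' e' u' c -> has_code S e u c.
Proof.
move=> fi /existsP[g gi]; apply/existsP; exists [ffun x => g (f x)].
have /sisoP[h1 h2 h3 h4] := siso_comp fi gi; apply/sisoP; split.
- by move=> x y xS yS; rewrite !ffunE; apply: h1.
- by rewrite -h2; apply: eq_imset => x; rewrite ffunE.
- by move=> x y xS yS; rewrite !ffunE; apply: h3.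
- by move=> x xS; rewrite ffunE; apply: h4.
Qed.

End Two.

Section Three.
Variables (V W : finType) (S : {set V}) (e : rel V) (u : pred V).
Variables (S' : {set W}) (e' : rel W) (u' : pred W).

(** With isomorphisms in both directions the predicates [has_code] coincide, hence [pick] selects
    the same code. *)
Lemma siso_code (f : V -> W) x0 : x0 \in S ->
  siso S e u S' e' u' f -> code S e u = code S' e' u'.
Proof.
move=> x0S fi; have [g gi] := siso_sym x0S fi.
congr odflt; apply: eq_pick => c.
by apply/idP/idP; apply: has_code_siso; [exact: gi | exact: fi].
Qed.

(** The size bounds make both codings genuine; one is composed with the inverse of the other. *)
Lemma code_siso y0 : y0 \in S' -> #|S| <= D.+1 -> #|S'| <= D.+1 ->
  code S e u = code S' e' u' -> exists f, siso S e u S' e' u' f.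
Proof.
move=> y0S /siso_pos-/(_ e u) p1 /siso_pos-/(_ e' u') p2 ceq.
have [g gi] := siso_sym y0S p2; rewrite -ceq in gi.
by exists (g \o pos S e u); apply: siso_comp p1 gi.
Qed.

End Three.
End Codes.

Section BallIso.
Variables (G H : sgraph).
Implicit Types (x y : G) (r k s : nat).

Definition biso r x (x' : H) (f : G -> H) : bool :=
  siso (ball_set x r) (adj G) (pred1 x) (ball_set x' r) (adj H) (pred1 x') f.

Lemma biso_root r x (x' : H) f : biso r x x' f -> f x = x'.
Proof.
case/sisoP => _ _ _ /(_ x (root_in_ball _ _)) /=; rewrite eqxx.
by move/eqP.
Qed.

Lemma biso_inj r x (x' : H) f :
  biso r x x' f -> {in ball_set x r &, injective f}.
Proof. by case/sisoP. Qed.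

Lemma biso_im r x (x' : H) f : biso r x x' f -> f @: ball_set x r = ball_set x' r.
Proof. by case/sisoP. Qed.

Lemma biso_adj r x (x' : H) f : biso r x x' f ->
  {in ball_set x r &, forall y z, adj H (f y) (f z) = adj G y z}.
Proof. by case/sisoP. Qed.

Lemma biso_mem_ball r x (x' : H) f y k s z : biso r x x' f ->
  y \in ball_set x k -> k + s <= r ->
  z \in ball_set y s -> f z \in ball_set (f y) s.
Proof.
move=> bi yx; elim: s z => [|s IH] z ks; first by rewrite !in_ball0 => /eqP ->.
case/in_ballSP => [->|[w wy wz]]; first exact: root_in_ball.
have ws : f w \in ball_set (f y) s by apply: IH wy; apply: leq_trans ks; rewrite addnS.
apply: mem_ballS ws _; rewrite (biso_adj bi) //.
  apply: (subsetP (sub_ball x _)) (mem_ball_trans yx wy).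
  by apply: leq_trans ks; rewrite addnS.
exact: (subsetP (sub_ball x ks)) (mem_ball_trans yx (mem_ballS wy wz)).
Qed.

(** Walks of length at most [s] from [y] stay in the ball of radius [r] around [x]. They are pushed
    forward by [f], and walks from [f y] are lifted back one edge at a time, which gives
    surjectivity. *)
Lemma biso_sub r x (x' : H) f y k s : biso r x x' f ->
  y \in ball_set x k -> k + s <= r -> biso s y (f y) f.
Proof.
move=> bi yx ksr.
have sub t : t <= s -> {subset ball_set y t <= ball_set x r}.
  move=> ts z zy; apply: (subsetP (sub_ball x ksr)).
  by apply: mem_ball_trans yx _; apply: (subsetP (sub_ball y ts)).
have yr : y \in ball_set x r by apply: (sub 0) => //; rewrite in_ball0.
apply/sisoP; split.
- by move=> a b /(sub _ (leqnn _)) a' /(sub _ (leqnn _)) b'; apply: (biso_inj bi).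
- elim: s ksr sub => [|s IH] ksr sub; apply/setP => w; apply/imsetP/idP.
  + by case=> z; rewrite in_ball0 => /eqP -> ->; apply: root_in_ball.
  + by rewrite in_ball0 => /eqP ->; exists y; rewrite ?root_in_ball.
  + by case=> z zy ->; apply: (biso_mem_ball bi yx ksr).
  have ksr' : k + s <= r by apply: leq_trans ksr; rewrite addnS.
  have {}IH : f @: ball_set y s = ball_set (f y) s.
    by apply: IH ksr' _ => t ts; apply: sub; rewrite ltnW.
  case/in_ballSP => [->|[w' w'y aw]]; first by exists y; rewrite ?root_in_ball.
  have fyk : f y \in ball_set x' k.
    rewrite -(biso_root bi); apply: (@biso_mem_ball r x x' f x 0) => //.
      exact: root_in_ball.
    by apply: leq_trans ksr; rewrite add0n leq_addr.
  have : w \in ball_set x' r.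
    by apply: (subsetP (sub_ball x' ksr)); apply: mem_ball_trans fyk (mem_ballS w'y aw).
  rewrite -(biso_im bi) => /imsetP[z zr wz]; exists z => //.
  move: w'y; rewrite -IH => /imsetP[z' z'y wz'].
  apply: (mem_ballS z'y); rewrite -(biso_adj bi) -?wz -?wz' //.
  exact: (sub s (leqnSn s)).
- by move=> a b /(sub _ (leqnn _)) a' /(sub _ (leqnn _)) b'; apply: (biso_adj bi).
- move=> z /(sub _ (leqnn _)) zr /=; apply/eqP/eqP => [|-> //].
  by apply: (biso_inj bi).
Qed.

End BallIso.

(** Under the degree bound [d] the ball has at most [d.+1 ^ r] vertices, so the code determines it
    up to rooted isomorphism. *)
Definition ball_type (d r : nat) (G : sgraph) (x : G) : gcode (d.+1 ^ r) :=
  code (d.+1 ^ r) (ball_set x r) (adj G) (pred1 x).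

Section BallType.
Variables (d : nat) (G H : sgraph).
Hypotheses (dG : max_degree d G) (dH : max_degree d H).

Lemma ball_type_biso r (x : G) (y : H) :
  ball_type d r x = ball_type d r y -> exists f, biso r x y f.
Proof.
by apply: (@code_siso _ _ _ _ _ _ _ _ _ y (root_in_ball _ _));
  apply: leqW; apply: card_ball.
Qed.

Lemma biso_ball_type r (x : G) (y : H) f :
  biso r x y f -> ball_type d r x = ball_type d r y.
Proof. exact: (siso_code _ (root_in_ball x r)). Qed.

Lemma ball_type_le r s (x : G) (y : H) : s <= r ->
  ball_type d r x = ball_type d r y -> ball_type d s x = ball_type d s y.
Proof.
move=> sr /ball_type_biso[f bi]; rewrite -(biso_root bi).
by apply: (biso_ball_type (f := f)); apply: biso_sub bi (root_in_ball x 0) _.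
Qed.

End BallType.

(** * Matching cells of equal code *)

(** The relation [m] is a bijection between its domain and its range; their complements have equal
    size and are matched by position in their enumerations. *)
Lemma extend_partial_matching (X Y : finType) (m : X -> Y -> bool) :
  #|X| = #|Y| ->
  (forall x y y', m x y -> m x y' -> y = y') ->
  (forall x x' y, m x y -> m x' y -> x = x') ->
  exists2 g : {ffun X -> Y}, injective g & forall x y, m x y -> g x = y.
Proof.
move=> XY fm im.
case: (pickP (@predT Y)) => [y0 _|Y0]; last first.
  have X0 (x : X) : False.
    have : 0 < #|Y| by rewrite -XY; apply/card_gt0P; exists x.
    by case/card_gt0P => y; move: (Y0 y).
  by exists [ffun x => False_rect Y (X0 x)] => [x|x]; case: (X0 x).
pose h x := odflt y0 [pick y | m x y].
have hP x y : m x y -> h x = y.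
  move=> xy; rewrite /h; case: pickP => [y' xy'|/(_ y)]; first exact: fm xy' xy.
  by rewrite xy.
pose D := [set x | [exists y, m x y]]; pose E := [set y | [exists x, m x y]].
have DP x : x \in D -> m x (h x).
  by rewrite inE => /existsP[y xy]; rewrite (hP x y).
have hD : {in D &, injective h}.
  by move=> x x' /DP xh /DP xh' e; apply: (im x x' (h x)); rewrite // e.
have ED : E = h @: D.
  apply/setP => y; apply/idP/imsetP => [|[x xD ->]].
    by rewrite inE => /existsP[x xy]; exists x; rewrite ?(hP x y) // inE; apply/existsP; exists y.
  by rewrite inE; apply/existsP; exists x; apply: DP.
have cD : #|~: D| = #|~: E|.
  by have := cardsC D; rewrite XY -(cardsC E) ED card_in_imset // => /addnI.
pose t x := nth y0 (enum (~: E)) (index x (enum (~: D))).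
have tlt x : x \notin D -> index x (enum (~: D)) < size (enum (~: E)).
  by move=> xD; rewrite -cardE -cD cardE index_mem mem_enum inE.
have tE x : x \notin D -> t x \notin E.
  by move=> xD; rewrite -in_setC -mem_enum mem_nth ?tlt.
have tinj x x' : x \notin D -> x' \notin D -> t x = t x' -> x = x'.
  move=> xD xD' /eqP; rewrite nth_uniq ?tlt ?enum_uniq // => /eqP e.
  by move: e; apply: (index_inj x); rewrite mem_enum in_setC.
exists [ffun x => if x \in D then h x else t x] => [x x'|x y xy]; rewrite !ffunE.
  case: ifP => xD; case: ifP => xD'; first exact: hD.
  - by move=> e; have := tE _ (negbT xD'); rewrite -e ED imset_f.
  - by move=> e; have := tE _ (negbT xD); rewrite e ED imset_f.
  - by apply: tinj; rewrite ?xD ?xD'.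
by rewrite ifT ?(hP x y) // inE; apply/existsP; exists y.
Qed.

(* A family of disjoint vertex sets ("cells") of a graph, each one identified with
   the graph on [c.1.1] with edges [c.1.2], where [c] is its code; the vertices in
   positions outside [c.2] have all their neighbours in their own cell.  Vertices
   with code [None] are left out. *)
Record cellular (D : nat) (X : sgraph) (I : finType) (cell : X -> I)
    (k : X -> option (gcode D)) (p : X -> 'I_D.+1) : Prop := Cellular {
  cell_code : forall x x', cell x = cell x' -> k x = k x';
  cell_inj : forall x x' c, k x = Some c -> cell x = cell x' -> p x = p x' -> x = x';
  cell_pos : forall x c, k x = Some c -> p x \in c.1.1;
  cell_surj : forall x c i, k x = Some c -> i \in c.1.1 ->
    exists2 x', cell x' = cell x & p x' = i;
  cell_adj : forall x x' c, k x = Some c -> cell x = cell x' ->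
    adj X x x' = ((p x, p x') \in c.1.2);
  cell_nbr : forall x x' c, k x = Some c -> p x \notin c.2 -> adj X x x' ->
    cell x' = cell x }.

Section Cells.
Variables (D : nat) (X : sgraph) (I : finType) (cell : X -> I).
Variables (k : X -> option (gcode D)) (p : X -> 'I_D.+1).
Hypothesis cX : cellular cell k p.

Definition cells c : {set I} := cell @: [set x | k x == Some c].
(** Numbers the cells of each code. Code, rank and position together determine a vertex, which is
    how cells of two graphs get matched. *)
Definition rank (x : X) : nat :=
  if k x is Some c then index (cell x) (enum (cells c)) else 0.

Lemma mem_cells x c : k x = Some c -> cell x \in cells c.
Proof. by move=> kx; rewrite imset_f // inE kx. Qed.

Lemma cell_key_inj x x' c : k x = Some c -> k x' = Some c -> p x = p x' ->
  rank x = rank x' -> x = x'.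
Proof.
rewrite /rank => kx kx' pp; rewrite kx kx' => e; apply: (cell_inj cX kx) => //.
by move: e; apply: (index_inj (cell x)); rewrite mem_enum mem_cells.
Qed.

(** The map [p] is a bijection from each cell of code [c] onto [c.1.1]. *)
Lemma card_cells_in c (Z : {set I}) : Z \subset cells c ->
  #|[set x | (k x == Some c) && (cell x \in Z)]| = #|Z| * #|c.1.1|.
Proof.
move=> ZS; rewrite -sum1dep_card (partition_big cell (mem Z)) /=; last first.
  by move=> x /andP[].
rewrite -sum_nat_const; apply: eq_bigr => i iZ; rewrite sum1dep_card.
have /imsetP[x0] := subsetP ZS i iZ; rewrite inE => /eqP kx0 ix0.
have im : c.1.1 = p @: [set x | (k x == Some c) && (cell x == i)].
  apply/setP => j; apply/idP/imsetP => [jc|[x]].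
    have [x cx <-] := cell_surj cX kx0 jc; exists x => //.
    by rewrite inE (cell_code cX cx) kx0 cx ix0 !eqxx.
  by rewrite inE => /andP[/eqP kx _] ->; apply: (cell_pos cX kx).
rewrite im card_in_imset.
  apply: eq_card => x; rewrite !inE; case: eqP => //= _.
  by case: (cell x =P i) => [->|]; rewrite ?andbT ?andbF // -topredE /= iZ.
move=> x x'; rewrite !inE => /andP[/eqP kx /eqP cx] /andP[_ /eqP cx'].
by apply: (cell_inj cX kx); rewrite cx.
Qed.

Lemma card_code c : #|[set x | k x == Some c]| = #|cells c| * #|c.1.1|.
Proof.
rewrite -card_cells_in //; apply: eq_card => x; rewrite !inE.
by case: (k x =P Some c) => // kx; rewrite mem_cells.
Qed.

Lemma card_high_rank c n :
  #|[set x | (k x == Some c) && (n <= rank x)]| <= (#|cells c| - n) * #|c.1.1|.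
Proof.
pose Z := [set i in cells c | n <= index i (enum (cells c))].
have ZS : Z \subset cells c by apply/subsetP => i; rewrite inE => /andP[].
apply: leq_trans (_ : #|Z| * #|c.1.1| <= _).
  rewrite -card_cells_in // subset_leq_card //; apply/subsetP => x.
  rewrite !inE => /andP[/eqP kx]; rewrite /rank kx eqxx => ->.
  by rewrite mem_cells.
rewrite leq_mul2r; apply/orP; right.
rewrite (cardE (cells c)) -size_drop; apply: leq_trans (card_size _).
apply: subset_leq_card; apply/subsetP => i; rewrite inE => /andP[ic ni].
have ic' : i \in enum (cells c) by rewrite mem_enum.
have := ic'; rewrite -{1}(cat_take_drop n (enum (cells c))) mem_cat => /orP[|//].
by rewrite in_take // ltnNge ni.
Qed.

End Cells.

Section Matching.
Variables (D : nat) (X Y : sgraph) (I J : finType).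
Variables (cellX : X -> I) (kX : X -> option (gcode D)) (pX : X -> 'I_D.+1).
Variables (cellY : Y -> J) (kY : Y -> option (gcode D)) (pY : Y -> 'I_D.+1).
Hypotheses (cX : cellular cellX kX pX) (cY : cellular cellY kY pY).
Hypothesis XY : #|X| = #|Y|.

Let m (x : X) (y : Y) : bool :=
  [&& kX x != None, kX x == kY y, pX x == pY y
    & rank cellX kX x == rank cellY kY y].

Let mP x y : m x y -> exists c,
  [/\ kX x = Some c, kY y = Some c, pX x = pY y & rank cellX kX x = rank cellY kY y].
Proof.
by case/and4P; case: (kX x) => // c _ /eqP <- /eqP -> /eqP ->; exists c.
Qed.

Let m_exists x c : kX x = Some c -> rank cellX kX x < #|cells cellY kY c| ->
  exists y, m x y.
Proof.
move=> kx; set j := rank _ _ _ => jlt.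
have /card_gt0P[i0 _] : 0 < #|cells cellY kY c| by apply: leq_trans jlt.
have jlt' : j < size (enum (cells cellY kY c)) by rewrite -cardE.
have : nth i0 (enum (cells cellY kY c)) j \in cells cellY kY c.
  by rewrite -mem_enum mem_nth.
case/imsetP => y0; rewrite inE => /eqP ky0 e.
have [y cy py] := cell_surj cY ky0 (cell_pos cX kx).
exists y; have ky : kY y = Some c by rewrite (cell_code cY cy).
rewrite /m kx ky py !eqxx /= -/j /rank ky cy -e index_uniq ?enum_uniq //.
Qed.

Let m_cellX x y u : m x y -> cellX u = cellX x ->
  exists2 z, m u z & cellY z = cellY y.
Proof.
case/mP => c [kx ky pxy rxy] cu.
have ku : kX u = Some c by rewrite (cell_code cX cu).
have [z cz pz] := cell_surj cY ky (cell_pos cX ku).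
have kz : kY z = Some c by rewrite (cell_code cY cz).
exists z => //; rewrite /m ku kz pz !eqxx /=.
by move: rxy; rewrite /rank kx ky ku kz cu cz => ->.
Qed.

Let m_cellY x y z : m x y -> cellY z = cellY y ->
  exists2 u, m u z & cellX u = cellX x.
Proof.
case/mP => c [kx ky pxy rxy] cz.
have kz : kY z = Some c by rewrite (cell_code cY cz).
have [u cu pu] := cell_surj cX kx (cell_pos cY kz).
have ku : kX u = Some c by rewrite (cell_code cX cu).
exists u => //; rewrite /m ku kz pu !eqxx /=.
by move: rxy; rewrite /rank kx ky ku kz cu cz => ->.
Qed.

(** The cells of a code are matched in order of rank, position by position. A matched vertex at a
    position outside [c.2] has all its neighbours in its cell on both sides, so its star is
    preserved. What remains are the vertices counted by the first term and those in surplus cells of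
    [X], counted by the truncated differences. *)
Lemma cell_matching : exists2 g : {ffun X -> Y}, injective g &
  #|[set v | nbr X v != nbr (pullback g Y) v]| <=
  #|[set x | if kX x is Some c then pX x \in c.2 else true]| +
  \sum_c (#|[set x | kX x == Some c]| - #|[set y | kY y == Some c]|).
Proof.
have [||g ginj gm] := @extend_partial_matching X Y m XY.
- move=> x y y' /mP[c [kx ky pxy rxy]] /mP[c' [kx' ky' pxy' rxy']].
  have ce : c' = c by move: kx'; rewrite kx => -[].
  by rewrite ce in ky'; apply: (cell_key_inj cY ky ky'); rewrite -?pxy -?rxy.
- move=> x x' y /mP[c [kx ky pxy rxy]] /mP[c' [kx' ky' pxy' rxy']].
  have ce : c' = c by move: ky'; rewrite ky => -[].
  by rewrite ce in kx'; apply: (cell_key_inj cX kx kx'); rewrite ?pxy ?rxy.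
exists g => //.
pose U := \bigcup_c [set x | (kX x == Some c) && (#|cells cellY kY c| <= rank cellX kX x)].
pose B := [set x | if kX x is Some c then pX x \in c.2 else true].
apply: leq_trans (_ : #|B :|: U| <= _); last first.
  apply: leq_trans (leq_card_setU _ _) _; rewrite leq_add2l.
  apply: leq_trans (leq_card_bigcup _ _) _; apply: leq_sum => c _.
  apply: leq_trans (card_high_rank cX _ _) _.
  by rewrite mulnBl (card_code cX) (card_code cY).
apply: subset_leq_card; apply/subsetP => v; apply: contraLR.
rewrite !inE negb_or negbK => /andP[vB vU]; apply/eqP/setP => u; rewrite !inE /=.
case kv : (kX v) vB => [c|//] pv.
have [y vy] : exists y, m v y.
  apply: (m_exists kv); rewrite ltnNge; apply: contra vU => H.
  by apply/bigcupP; exists c => //; rewrite inE kv eqxx.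
have gv := gm _ _ vy.
have [c' [kv' ky pvy _]] := mP vy; move: kv' ky; rewrite kv => -[<-] ky {c'}.
have inside : cellX u = cellX v -> m u (g u) -> cellY (g u) = cellY (g v) ->
    adj X v u = adj Y (g v) (g u).
  move=> cu /mP[c' [ku kgu pu _]]; rewrite gv => cgu.
  by rewrite (cell_adj cX kv (esym cu)) (cell_adj cY ky (esym cgu)) pvy pu.
have [vu|nvu] := boolP (adj X v u).
  have cu := cell_nbr cX kv pv vu.
  have [z uz cz] := m_cellX vy cu; have gu := gm _ _ uz.
  by rewrite -inside ?gu ?gv.
(* Conversely, a neighbour of [g v] lies in the cell of [g v], hence is matched with some [w] in the
   cell of [v]; injectivity of [g] identifies [w] with [u]. *)
apply/esym/negbTE; apply: contra nvu => gvu.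
have cgu : cellY (g u) = cellY y.
  by rewrite -gv; apply: (cell_nbr cY (c := c)) gvu; rewrite gv // -pvy.
have [w wu cw] := m_cellY vy cgu.
have wu' : w = u by apply: ginj; apply: gm.
by rewrite wu' in wu cw; rewrite inside // gv.
Qed.

End Matching.

(** * Bounded pieces and their lifts *)

(** A partition given by the class of each vertex; of the connectedness of classes only the distance
    bound [piece_ball] is kept. *)
Record pieces (G : sgraph) (K : nat) (C : G -> {set G}) : Prop := Pieces {
  piece_refl : forall x, x \in C x;
  piece_eq : forall x y, y \in C x -> C y = C x;
  card_piece : forall x, #|C x| <= K;
  piece_ball : forall x, C x \subset ball_set x K }.

Definition touching (G : sgraph) (C : G -> {set G}) : {set G} :=
  [set x | [exists y, adj G x y && (y \notin C x)]].

(** The pieces are the components left by the cut. A repetition-free walk inside one is shorter than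
    its size, and every touching vertex is one of the two ends of a removed edge. *)
Lemma pieces_of_edge_cut (G : sgraph) (F : {set {set G}}) (K : nat) :
  F \subset edges G -> (forall x : remove_edges F, #|component x| <= K) ->
  exists2 C, @pieces G K C & #|touching C| <= 2 * #|F|.
Proof.
move=> FE cK; pose H := remove_edges F.
have Hsym : connect_sym (adj H) by apply/sym_connect_sym/adj_sym.
exists (fun x => @component H x).
  split=> [x|x y|x|x]; first by rewrite inE connect0.
  - rewrite inE => xy; apply/setP => z; rewrite !inE.
    by apply/esym/(same_connect Hsym).
  - exact: cK.
  apply/subsetP => y; rewrite inE => /connectP[p0 pp0 ly].
  case/shortenP: pp0 ly => p pp up _ ly.
  apply/in_ballP; exists p.
    by apply: sub_path pp => u v /andP[].
  split=> //; apply: leq_trans (cK x).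
  apply: leq_trans (leqnSn (size p)) _; rewrite -[(size p).+1]/(size (x :: p)) -(card_uniqP up).
  apply/subset_leq_card/subsetP => z; rewrite inE => zp; rewrite inE.
  by apply: (path_connect pp).
apply: leq_trans (_ : #|\bigcup_(e in F) e| <= _).
  apply/subset_leq_card/subsetP => x; rewrite inE => /existsP[y /andP[xy]].
  rewrite inE => ny; apply/bigcupP; exists [set x; y]; last by rewrite !inE eqxx.
  apply: contraR ny => nF; apply: connect1; apply/andP; split=> //.
apply: leq_trans (leq_card_bigcup _ _) _; rewrite mulnC -sum_nat_const.
apply: leq_sum => e /(subsetP FE); rewrite inE => /existsP[x /existsP[y /andP[_ /eqP ->]]].
by rewrite cards2; case: (_ != _).
Qed.

Definition shallow (H : sgraph) (Q : H -> {set H}) (K : nat) : {set H} :=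
  [set y | ~~ (ball_set y K \subset Q y)].

(** A walk from [y] leaving [Q y] does so through a touching vertex, so a shallow vertex is within
    distance [K] of one. *)
Lemma card_shallow (d K L : nat) (H : sgraph) (Q : H -> {set H}) :
  max_degree d H -> pieces L Q ->
  #|shallow Q K| <= #|touching Q| * d.+1 ^ K.
Proof.
move=> dH pQ.
have sub : shallow Q K \subset \bigcup_(u in touching Q) ball_set u K.
  apply/subsetP => y; rewrite inE => /subsetPn[z zy zQ].
  suff : exists2 u, u \in touching Q & u \in ball_set y K.
    by case=> u ut uy; apply/bigcupP; exists u; rewrite // mem_ball_sym.
  elim: K z zy zQ => [|K IH] z.
    by rewrite in_ball0 => /eqP ->; rewrite (piece_refl pQ).
  case/in_ballSP => [->|[w wy wz]] zQ; first by rewrite (piece_refl pQ) in zQ.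
  have [wQ|/(IH _ wy)[u ut uy]] := boolP (w \in Q y); last first.
    by exists u => //; apply: (subsetP (sub_ball y (leqnSn K))).
  exists w; last exact: (subsetP (sub_ball y (leqnSn K))).
  by rewrite inE; apply/existsP; exists z; rewrite wz (piece_eq pQ wQ).
apply: leq_trans (subset_leq_card sub) _.
apply: leq_trans (leq_card_bigcup _ _) _; rewrite -sum_nat_const.
by apply: leq_sum => u _; apply: card_ball.
Qed.

Section PieceCode.
Variables (G : sgraph) (K : nat) (C : G -> {set G}).
Hypothesis pC : pieces K C.

Definition touch_pred : pred G := fun x => x \in touching C.
Definition piece_code (x : G) : gcode K := code K (C x) (adj G) touch_pred.
Definition piece_pos (x : G) : 'I_K.+1 := pos K (C x) (adj G) touch_pred x.

Let sp x := sisoP _ _ _ _ _ _ _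
  (@siso_pos K G (C x) (adj G) touch_pred (leqW (card_piece pC x))).

Lemma piece_posE x y : y \in C x -> piece_pos y = pos K (C x) (adj G) touch_pred y.
Proof. by move=> yx; rewrite /piece_pos (piece_eq pC yx). Qed.

Lemma piece_pos_inj x y z : y \in C x -> z \in C x ->
  piece_pos y = piece_pos z -> y = z.
Proof. by move=> yx zx; rewrite !(@piece_posE x) //; case: (sp x) => + _ _ _; apply. Qed.

Lemma piece_pos_im x : piece_pos @: C x = (piece_code x).1.1.
Proof.
by case: (sp x) => _ <- _ _; apply: eq_in_imset => y yx; apply: piece_posE.
Qed.

Lemma piece_pos_adj x y z : y \in C x -> z \in C x ->
  adj G y z = ((piece_pos y, piece_pos z) \in (piece_code x).1.2).
Proof. by move=> yx zx; rewrite !(@piece_posE x) //; case: (sp x) => _ _ /(_ y z yx zx). Qed.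

Lemma piece_pos_touch x y : y \in C x ->
  (y \in touching C) = (piece_pos y \in (piece_code x).2).
Proof. by move=> yx; rewrite (@piece_posE x) //; case: (sp x) => _ _ _ /(_ y yx). Qed.

Lemma cellular_copies q :
  cellular (X := copies q G) (fun w : copies q G => (w.1, C w.2))
    (fun w => Some (piece_code w.2)) (fun w => piece_pos w.2).
Proof.
have CE x y : C x = C y -> y \in C x by move=> ->; apply: piece_refl pC _.
split=> /=.
- by move=> [i x] [j y] /= [_ xy]; rewrite /piece_code xy.
- move=> [i x] [j y] c /= _ [-> xy] e; congr (_, _).
  by apply: (piece_pos_inj (piece_refl pC x) (CE _ _ xy) e).
- move=> [i x] c /= [<-]; rewrite -piece_pos_im.
  by apply: imset_f; apply: piece_refl pC _.
- move=> [i x] c j /= [<-]; rewrite -piece_pos_im => /imsetP[y yx ->].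
  by exists (i, y); rewrite //= (piece_eq pC yx).
- move=> [i x] [j y] c /= [<-] [-> xy]; rewrite eqxx /=.
  exact: (piece_pos_adj (piece_refl pC x) (CE _ _ xy)).
move=> [i x] [j y] c /= [<-]; rewrite -piece_pos_touch ?(piece_refl pC) //.
rewrite inE => /existsPn/(_ y) h /andP[/eqP -> xy] /=; congr (_, _).
by apply: (piece_eq pC); move: h; rewrite xy negbK.
Qed.

End PieceCode.

Lemma card_copies_set (G : sgraph) (q : nat) (A : {set G}) :
  #|[set w : copies q G | w.2 \in A]| = q * #|A|.
Proof.
transitivity #|setX [set: 'I_q] A|; last by rewrite cardsX cardsT card_ord.
by apply: eq_card => w; rewrite !inE.
Qed.

Section Lifting.
Variables (G H : sgraph) (K L r p : nat) (C : G -> {set G}) (Q : H -> {set H}).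
Hypotheses (pC : pieces K C) (pQ : pieces L Q).
Variables (rt : H -> H) (kept : pred H) (Phi : 'I_p -> H -> {ffun H -> G}).
Hypothesis rtQ : forall y, y \in ball_set (rt y) L.
Hypothesis rt_eq : forall y z, z \in Q y -> rt z = rt y.
Hypothesis rL : L + K.+1 <= r.
Hypothesis kept_biso : forall i y, kept (rt y) ->
  biso r (rt y) (Phi i (rt y) (rt y)) (Phi i (rt y)).

(** Copy [i] of the piece with root [x] is mapped to [G] by the embedding [Phi i x]. *)
Definition vlift (w : copies p H) : G := Phi w.1 (rt w.2) w.2.

(** The inclusion discards pieces of [G] that the image of the piece of [H] covers only partly,
    since these pull back to truncated cells. *)
Definition lift_code (w : copies p H) : option (gcode K) :=
  if kept (rt w.2) && (C (vlift w) \subset Phi w.1 (rt w.2) @: Q w.2)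
  then Some (piece_code K C (vlift w)) else None.

Definition lift_cell (w : copies p H) := (w.1, Q w.2, C (vlift w)).

Let Q_ball y z : z \in Q y -> z \in ball_set (rt y) L.
Proof. by move=> zy; rewrite -(rt_eq zy); apply: rtQ. Qed.

Let lift_codeP w c : lift_code w = Some c ->
  [/\ kept (rt w.2), C (vlift w) \subset Phi w.1 (rt w.2) @: Q w.2
    & piece_code K C (vlift w) = c].
Proof. by rewrite /lift_code; case: ifP => // /andP[-> ->] [->]. Qed.

Lemma cellular_lift :
  cellular lift_cell lift_code (fun w => piece_pos K C (vlift w)).
Proof.
have CE x y : C x = C y -> y \in C x by move=> ->; apply: piece_refl pC _.
have QE x y : Q x = Q y -> y \in Q x by move=> ->; apply: piece_refl pQ _.
have rL' : L <= r by apply: leq_trans rL; rewrite leq_addr.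
have Q_r y z : z \in Q y -> z \in ball_set (rt y) r.
  by move=> zy; apply: (subsetP (sub_ball _ rL')); apply: Q_ball.
split.
- move=> [i y] [j z] [/= <- yz cyz]; rewrite /lift_code /=.
  by rewrite (rt_eq (QE _ _ yz)) -cyz yz /piece_code cyz.
- move=> [i y] [j z] c /lift_codeP[/= ky _ _] [/= <- yz cyz] e; congr (_, _).
  have e' := piece_pos_inj pC (piece_refl pC _) (CE _ _ cyz) e.
  apply: (biso_inj (kept_biso i ky)); first exact: Q_r (piece_refl pQ y).
    exact: Q_r (QE _ _ yz).
  by move: e'; rewrite /vlift /= (rt_eq (QE _ _ yz)).
- move=> w c /lift_codeP[_ _ <-]; rewrite -(piece_pos_im pC).
  by apply: imset_f; apply: piece_refl pC _.
- move=> [i y] c j /lift_codeP[/= _ full <-]; rewrite -(piece_pos_im pC).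
  move=> /imsetP[v vC ->]; have /imsetP[z zy vz] := subsetP full v vC.
  have lz : vlift (i, z) = v by rewrite /vlift /= (rt_eq zy) vz.
  exists (i, z); rewrite /lift_cell /= lz // (piece_eq pQ zy).
  by rewrite (piece_eq pC vC).
- move=> [i y] [j z] c /lift_codeP[/= ky _ <-] [/= <- yz cyz]; rewrite eqxx /=.
  rewrite -(piece_pos_adj pC (piece_refl pC _) (CE _ _ cyz)).
  have zy := QE _ _ yz.
  by rewrite /vlift /= (rt_eq zy) (biso_adj (kept_biso i ky)) ?Q_r ?(piece_refl pQ).
move=> [i y] [j z] c /lift_codeP[/= ky full <-].
rewrite -(piece_pos_touch pC) ?(piece_refl pC) // inE => /existsPn h.
move=> /andP[/= /eqP <- yz]; have b := kept_biso i ky.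
have yr : y \in ball_set (rt y) r by apply: Q_r (piece_refl pQ y).
(* The neighbour [z] may a priori lie outside [Q y], but within [L.+1] of the root the embedding is
   still an isomorphism. As the piece of [G] is fully covered, the image of [z] comes from [Q y],
   and so does [z] by injectivity. *)
have zr : z \in ball_set (rt y) r.
  apply: (subsetP (sub_ball (rt y) (leq_trans (_ : L.+1 <= _) rL))) (mem_ballS (rtQ y) yz).
  by rewrite addnS ltnS leq_addr.
have zC : Phi i (rt y) z \in C (vlift (i, y)).
  have := h (Phi i (rt y) z); rewrite /vlift /= (biso_adj b) // yz /=.
  by rewrite negbK.
have /imsetP[z' z'y e] := subsetP full _ zC.
have zz' : z = z' by apply: (biso_inj b) => //; apply: Q_r.
rewrite -zz' in z'y; rewrite /lift_cell /= (piece_eq pQ z'y).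
by rewrite -(piece_eq pC zC) /vlift /= (rt_eq z'y).
Qed.

(** If the ball of radius [K] around [y] is inside [Q y], its image is the ball of radius [K] around
    the lift and contains the whole piece there; so only shallow vertices lose their code. *)
Lemma card_lift_code c :
  #|[set w | kept (rt w.2) && (piece_code K C (vlift w) == c)]| <=
  #|[set w | lift_code w == Some c]| +
  #|[set w : copies p H | (w.2 \in shallow Q K) && (piece_code K C (vlift w) == c)]|.
Proof.
apply: leq_trans _ (leq_card_setU _ _); apply/subset_leq_card/subsetP => -[i y].
rewrite !inE /= => /andP[ky /eqP cw]; rewrite cw eqxx andbT orbC -implybE.
apply/implyP => deep; rewrite /lift_code /= ky cw /=.
suff -> : C (vlift (i, y)) \subset Phi i (rt y) @: Q y by rewrite eqxx.
have b := kept_biso i ky.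
have bK : biso K y (vlift (i, y)) (Phi i (rt y)).
  by apply: (biso_sub b (rtQ y)); apply: leq_trans rL; rewrite leq_add2l.
apply: subset_trans (piece_ball pC _) _; rewrite -(biso_im bK).
exact: imsetS.
Qed.

Lemma matching_with_lift q : q * #|G| = p * #|H| ->
  exists2 g : {ffun copies q G -> copies p H}, injective g &
  #|[set v | nbr (copies q G) v != nbr (pullback g (copies p H)) v]| <=
  q * #|touching C| + p * #|shallow Q K| +
  \sum_c (q * #|[set x | piece_code K C x == c]|
          - #|[set w | kept (rt w.2) && (piece_code K C (vlift w) == c)]|).
Proof.
move=> qp; have cXY : #|copies q G| = #|copies p H|.
  by rewrite !card_prod !card_ord.
have [g ginj gle] := cell_matching (cellular_copies pC q) cellular_lift cXY.
exists g => //; apply: leq_trans gle _; rewrite -addnA; apply: leq_add.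
  rewrite -card_copies_set; apply/subset_leq_card/subsetP => w.
  by rewrite !inE -(piece_pos_touch pC) ?(piece_refl pC) // inE.
(* The shallow vertices are distributed over the codes of their lifts, so that each share can be
   absorbed into the truncated difference of its code. *)
have -> : p * #|shallow Q K| = \sum_c
   #|[set w : copies p H | (w.2 \in shallow Q K) && (piece_code K C (vlift w) == c)]|.
  rewrite -card_copies_set -sum1_card.
  rewrite (partition_big (fun w : copies p H => piece_code K C (vlift w)) xpredT) //=.
  apply: eq_bigr => c _; rewrite sum1dep_card; apply: eq_card => w.
  by rewrite !inE.
rewrite -big_split; apply: leq_sum => c _ /=.
have -> : #|[set x : copies q G | Some (piece_code K C x.2) == Some c]| =
    q * #|[set x | piece_code K C x == c]|.
  by rewrite -card_copies_set; apply: eq_card => w; rewrite !inE.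
rewrite leq_subLR addnA; apply: leq_trans _ (leq_add (card_lift_code c) (leqnn _)).
by rewrite -leq_subLR.
Qed.

End Lifting.

(** * Averages over types *)

Local Open Scope ring_scope.

Definition fiber (V T : finType) (k : V -> T) (t : T) : {set V} :=
  [set v | k v == t].

Lemma card_fiber (V T : finType) (k : V -> T) t :
  #|fiber k t| = #|[pred v | k v == t]|.
Proof. by apply: eq_card => v; rewrite !inE. Qed.

(* The value is [0] on an empty fiber. *)
Definition avg (R : realFieldType) (V T : finType) (k : V -> T) (f : V -> R)
    (t : T) : R :=
  (\sum_(v | k v == t) f v) / #|fiber k t|%:R.

Section Averages.
Variables (R : realFieldType) (V T : finType) (k : V -> T).
Implicit Types (f g m : V -> R).

Lemma fiber_avg f t : #|fiber k t|%:R * avg k f t = \sum_(v | k v == t) f v.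
Proof.
have [E|E] := eqVneq #|fiber k t| 0%N; last by rewrite mulrC divfK // pnatr_eq0.
rewrite E mul0r big1 // => v kv.
by move/eqP: E; rewrite cards_eq0 => /eqP/setP/(_ v); rewrite !inE kv.
Qed.

Lemma sum_fiber (F : T -> R) : \sum_v F (k v) = \sum_t #|fiber k t|%:R * F t.
Proof.
rewrite (partition_big k xpredT) //=; apply: eq_bigr => t _.
rewrite (eq_bigr (fun=> F t)) => [|v /eqP -> //].
by rewrite sumr_const -[LHS]mulr_natl card_fiber.
Qed.

Lemma sum_avg_adj m f : (forall v w, k v = k w -> m v = m w) ->
  \sum_v m v * avg k f (k v) = \sum_v m v * f v.
Proof.
move=> mk; rewrite (partition_big k xpredT) //= [RHS](partition_big k xpredT) //=.
apply: eq_bigr => t _.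
case: (pickP (fun v => k v == t)) => [v0 /eqP kv0|k0]; last by rewrite !big_pred0.
rewrite (eq_bigr (fun v => m v0 * avg k f t)); last first.
  by move=> v /eqP kv; rewrite kv (mk v v0) ?kv.
rewrite sumr_const [RHS](eq_bigr (fun v => m v0 * f v)); last first.
  by move=> v /eqP kv; rewrite (mk v v0) ?kv.
by rewrite -mulr_sumr -fiber_avg -[LHS]mulr_natl card_fiber mulrCA.
Qed.

Lemma avg_ge0 f t : (forall v, 0 <= f v) -> 0 <= avg k f t.
Proof. by move=> f0; rewrite divr_ge0 ?ler0n ?sumr_ge0. Qed.

Lemma avg_le1 f t : (forall v, f v <= 1) -> avg k f t <= 1.
Proof.
move=> f1; have [E|E] := eqVneq #|fiber k t| 0%N.
  by rewrite /avg E invr0 mulr0 ler01.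
rewrite ler_pdivrMr ?ltr0n ?lt0n // mul1r.
apply: le_trans (ler_sum _ (fun v _ => f1 v)) _.
by rewrite sumr_const card_fiber.
Qed.

Lemma sum_avg f : \sum_v avg k f (k v) = \sum_v f v.
Proof.
rewrite sum_fiber [RHS](partition_big k xpredT) //=.
by apply: eq_bigr => t _; rewrite fiber_avg.
Qed.

End Averages.

(** * Energies of conditional expectations *)

Section Energy.
Variables (R : realFieldType) (V : finType).

(** Pythagoras: since [k'] refines [k], the coarse average is the orthogonal projection of the fine
    one. *)
Lemma energy_step (T T' : finType) (k : V -> T) (k' : V -> T') (f : V -> R) :
  (forall v w, k' v = k' w -> k v = k w) ->
  \sum_v (avg k' f (k' v) - avg k f (k v)) ^+ 2 =
  \sum_v avg k' f (k' v) ^+ 2 - \sum_v avg k f (k v) ^+ 2.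
Proof.
move=> ref.
have E : \sum_v avg k f (k v) * avg k' f (k' v) = \sum_v avg k f (k v) ^+ 2.
  rewrite (sum_avg_adj f (m := fun v => avg k f (k v))) => [|v w /ref -> //].
  rewrite -(sum_avg_adj (k := k) f (m := fun v => avg k f (k v))) => [|v w -> //].
  by apply: eq_bigr => v _; rewrite expr2.
transitivity (\sum_v avg k' f (k' v) ^+ 2 - 2 * \sum_v avg k f (k v) * avg k' f (k' v)
   + \sum_v avg k f (k v) ^+ 2).
  rewrite mulr_sumr -sumrB -big_split /=; apply: eq_bigr => v _; ring.
by rewrite E; ring.
Qed.

Lemma small_increment (u : nat -> R) (M : R) (J : nat) :
  (0 < J)%N -> 0 <= u 0%N -> u J <= M ->
  exists2 j, (j < J)%N & u j.+1 - u j <= M / J%:R.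
Proof.
move=> J0 u0 uJ.
case: (boolP [exists j : 'I_J, u j.+1 - u j <= M / J%:R]) => [/existsP[j Hj]|].
  by exists j.
rewrite negb_exists => /forallP nH; exfalso.
have : M < u J - u 0%N; last by move=> ?; lra.
rewrite -(telescope_sumr u (leq0n J)) big_mkord.
have -> : M = \sum_(i < J) M / J%:R.
  by rewrite sumr_const card_ord -[RHS]mulr_natr divfK // pnatr_eq0 -lt0n.
apply: ltr_sum => [|i _]; first by apply/hasP; exists (Ordinal J0); rewrite ?mem_index_enum.
by rewrite ltNge nH.
Qed.

(** Summing the energies over all labels gives a single bounded increasing quantity, so that one
    index [j] serves every label at once. *)
Lemma refining_averages_stabilize (L : finType) (l : V -> L) (T : nat -> finType)
    (k : forall j, V -> T j) (J : nat) (eta : R) :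
  (forall j v w, k j.+1 v = k j.+1 w -> k j v = k j w) ->
  0 < eta -> 1 <= eta ^+ 2 * J%:R ->
  exists2 j, (j < J)%N & forall c,
    \sum_v `|avg (k j.+1) (fun w => (l w == c)%:R) (k j.+1 v)
             - avg (k j) (fun w => (l w == c)%:R) (k j v)| <= eta * #|V|%:R.
Proof.
move=> ref eta0 etaJ.
have J0 : (0 < J)%N by case: J etaJ => // ; rewrite mulr0 ler10.
pose a j c v : R := avg (k j) (fun w => (l w == c)%:R) (k j v).
have a0 j c v : 0 <= a j c v by apply: avg_ge0.
have a1 j c v : a j c v <= 1 by apply: avg_le1 => w; case: (_ == _); rewrite ?ler01.
pose u j := \sum_c \sum_v a j c v ^+ 2.
(* The averages lie between 0 and 1, so squares only decrease them, and their total over labels and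
   vertices is that of the indicators. *)
have uJ : u J <= #|V|%:R.
  rewrite /u exchange_big /=.
  have -> : #|V|%:R = \sum_(v : V) \sum_c a J c v.
    rewrite exchange_big /= (eq_bigr (fun c => \sum_v (l v == c)%:R)).
      rewrite exchange_big /= (eq_bigr (fun=> 1)) ?sumr_const // => v _.
      by rewrite (bigD1 (l v)) //= eqxx big1 ?addr0 // => c; rewrite eq_sym => /negPf ->.
    by move=> c _; apply: sum_avg.
  apply: ler_sum => v _; apply: ler_sum => c _.
  by rewrite expr2 ler_piMl.
have [|j jJ inc] := small_increment J0 _ uJ.
  by apply: sumr_ge0 => c _; apply: sumr_ge0 => v _; apply: sqr_ge0.
exists j => // c; rewrite -/(a _ _ _).
have incc : \sum_v (a j.+1 c v - a j c v) ^+ 2 <= #|V|%:R / J%:R.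
  apply: le_trans inc; rewrite /u -sumrB.
  rewrite (bigD1 c) //= -energy_step; last exact: ref.
  rewrite lerDl; apply: sumr_ge0 => c' _; rewrite -energy_step; last exact: ref.
  by apply: sumr_ge0 => v _; apply: sqr_ge0.
(* This passes from squares to absolute values; with [1 <= eta ^+ 2 * J%:R] both terms sum to at
   most [eta / 2 * #|V|%:R]. *)
have amgm v : `|a j.+1 c v - a j c v| <=
    (2 * eta)^-1 * (a j.+1 c v - a j c v) ^+ 2 + eta / 2.
  rewrite -real_normK ?num_real //; set x := `| _ |.
  rewrite -subr_ge0.
  have -> : (2 * eta)^-1 * x ^+ 2 + eta / 2 - x = (2 * eta)^-1 * (x - eta) ^+ 2.
    by field; rewrite ?lt0r_neq0.
  by rewrite mulr_ge0 ?sqr_ge0 // invr_ge0; lra.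
apply: le_trans (ler_sum _ (fun v _ => amgm v)) _.
rewrite big_split /= -mulr_sumr sumr_const -[_ *+ _]mulr_natr.
have : (2 * eta)^-1 * \sum_v (a j.+1 c v - a j c v) ^+ 2 <= eta / 2 * #|V|%:R.
  apply: le_trans (_ : (2 * eta)^-1 * (#|V|%:R / J%:R) <= _).
    by rewrite ler_wpM2l // invr_ge0; lra.
  have J0' : 0 < J%:R :> R by rewrite ltr0n.
  rewrite mulrA ler_pdivrMr // mulrC ler_pdivrMr; last by lra.
  have V0 : 0 <= #|V|%:R :> R by rewrite ler0n.
  have := ler_wpM2r V0 etaJ; rewrite mul1r => H.
  apply: le_trans H _; rewrite le_eqVlt; apply/orP; left; by apply/eqP; field.
by move=> ?; lra.
Qed.

End Energy.

(** * Comparison of the type distributions of two graphs *)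

Section Discrepancy.
Variables (R : realFieldType) (V W T : finType) (k : V -> T) (k' : W -> T).
Variable rho : R.
Hypothesis rho0 : 0 <= rho.

(** For [rho] equal to [#|W| / #|V|] this is [#|W|] times the l1 distance between the two
    distributions of types. *)
Definition discrepancy : R :=
  \sum_t `| #|fiber k' t|%:R - rho * #|fiber k t|%:R |.

(** The type is overrepresented in [W] at most by a factor 2; in particular, if it occurs in [W]
    then it occurs in [V]. *)
Definition common (t : T) : bool :=
  #|fiber k' t|%:R <= 2 * rho * #|fiber k t|%:R.

Lemma sum_avg_transfer (f : V -> R) : (forall v, 0 <= f v <= 1) ->
  rho * \sum_v f v - discrepancy <= \sum_w avg k f (k' w).
Proof.
move=> f01; rewrite -(sum_avg k) !sum_fiber mulr_sumr lerBlDr -big_split /=.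
apply: ler_sum => t _; rewrite mulrA -lerBlDl -mulrBl.
have a0 : 0 <= avg k f t by apply: avg_ge0 => v; case/andP: (f01 v).
have a1 : avg k f t <= 1 by apply: avg_le1 => v; case/andP: (f01 v).
apply: le_trans (_ : `|rho * #|fiber k t|%:R - #|fiber k' t|%:R| * avg k f t <= _).
  by rewrite ler_wpM2r // ler_norm.
by rewrite distrC ler_piMr.
Qed.

(** Unlike [sum_avg_transfer], this asks for no upper bound on the function: on common types, fiber
    sizes are compared multiplicatively. *)
Lemma sum_common_avg (g : V -> R) : (forall v, 0 <= g v) ->
  \sum_(w | common (k' w)) avg k g (k' w) <= 2 * rho * \sum_v g v.
Proof.
move=> g0; rewrite -(sum_avg k) sum_fiber mulr_sumr big_mkcond /=.
rewrite (sum_fiber k' (fun t => if common t then avg k g t else 0)).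
apply: ler_sum => t _; have a0 : 0 <= avg k g t by apply: avg_ge0.
rewrite /common; case: ifP => [ct|_]; first by rewrite mulrA ler_wpM2r.
by rewrite mulr0; apply: mulr_ge0; apply: mulr_ge0; rewrite ?ler0n.
Qed.

Lemma card_uncommon :
  #|[set w | ~~ common (k' w)]|%:R <= 2 * discrepancy.
Proof.
have -> : #|[set w | ~~ common (k' w)]|%:R = \sum_w (~~ common (k' w))%:R :> R.
  by rewrite -sum1dep_card natr_sum big_mkcond /=; apply: eq_bigr => w _; case: ifP.
rewrite (sum_fiber k' (fun t => (~~ common t)%:R)) mulr_sumr.
apply: ler_sum => t _; rewrite /common -ltNge.
case: ltP => [H|_]; last by rewrite mulr0 mulr_ge0.
rewrite mulr1; set x : R := #|_|%:R; set y : R := #|_|%:R.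
have := ler_norm (x - rho * y); rewrite -/x -/y in H *.
by move=> ?; nra.
Qed.

End Discrepancy.

(** * Random embeddings of balls *)

Lemma ler_sum_subset (R : realFieldType) (V : finType) (A B : {set V}) (F : V -> R) :
  (forall v, 0 <= F v) -> A \subset B -> \sum_(v in A) F v <= \sum_(v in B) F v.
Proof.
move=> F0 AB; rewrite [leRHS](big_setID A) /= (setIidPr AB) lerDl.
exact: sumr_ge0.
Qed.

(* Constant outside the ball, so that only the values on the ball count. *)
Definition ball_embeddings (H G : sgraph) (r : nat) (x : H) : {set {ffun H -> G}} :=
  [set phi : {ffun H -> G} | biso r x (phi x) phi &&
     [forall z, (z \notin ball_set x r) ==> (phi z == phi x)]].

Section Embeddings.
Variables (R : realFieldType) (d : nat) (G H : sgraph).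
Hypotheses (dG : max_degree d G) (dH : max_degree d H).
Implicit Types (x y : H) (r k s : nat) (phi : {ffun H -> G}).

Notation emb := (@ball_embeddings H G).

Lemma embP r x phi :
  reflect (biso r x (phi x) phi /\ forall z, z \notin ball_set x r -> phi z = phi x)
          (phi \in emb r x).
Proof.
rewrite inE; apply: (iffP andP) => [[b /forallP h]|[b h]]; split=> //.
  by move=> z zr; apply/eqP; move: (h z); rewrite zr.
by apply/forallP => z; apply/implyP => zr; apply/eqP/h.
Qed.

Lemma emb_type r x phi y k s : phi \in emb r x -> y \in ball_set x k ->
  (k + s <= r)%N -> ball_type d s (phi y) = ball_type d s y.
Proof.
move=> /embP[b _] yx ks; apply/esym; exact: biso_ball_type (biso_sub b yx ks).
Qed.

Lemma emb_neq0 r x (x' : G) : ball_type d r x = ball_type d r x' ->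
  (0 < #|emb r x|)%N.
Proof.
case/(ball_type_biso dH dG) => f bi; apply/card_gt0P.
exists [ffun z => if z \in ball_set x r then f z else f x].
have xr := root_in_ball x r; have fx := biso_root bi.
apply/embP; split=> [|z /negPf zr]; last by rewrite !ffunE zr xr.
rewrite ffunE xr fx; move/sisoP: bi => [h1 h2 h3 h4]; apply/sisoP; split.
- by move=> y z yr zr; rewrite !ffunE yr zr; apply: h1.
- by rewrite -h2; apply: eq_in_imset => y yr; rewrite ffunE yr.
- by move=> y z yr zr; rewrite !ffunE yr zr; apply: h3.
- by move=> y yr; rewrite !ffunE yr; apply: h4.
Qed.

(* Composing with an isomorphism between the large balls around [y1] and [y2]
   sends embeddings through [y1] to embeddings through [y2]. *)
Lemma card_emb_through r x y k (y1 y2 : G) : y \in ball_set x k -> (k <= r)%N ->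
  ball_type d (r + k) y1 = ball_type d (r + k) y2 ->
  (#|[set phi in emb r x | phi y == y1]| <= #|[set phi in emb r x | phi y == y2]|)%N.
Proof.
move=> yx kr /(ball_type_biso dG dG)[chi bc].
pose F (phi : {ffun H -> G}) : {ffun H -> G} := [ffun z => chi (phi z)].
have near phi : phi \in emb r x -> phi y = y1 -> phi x \in ball_set y1 k.
  move=> /embP[b _] <-; rewrite mem_ball_sym.
  exact: (biso_mem_ball b (root_in_ball x 0) _ yx).
(* The constant value outside the ball is covered too, so every value of [phi] lies where [chi] is
   injective. *)
have val phi z : phi \in emb r x -> phi y = y1 -> phi z \in ball_set y1 (r + k).
  move=> pe py; have xy1 := near _ pe py; case/embP: pe => b out; rewrite addnC.
  apply: mem_ball_trans xy1 _; case: (boolP (z \in ball_set x r)) => zr.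
    by rewrite -(biso_im b) imset_f.
  by rewrite out // root_in_ball.
have injF : {in [set phi in emb r x | phi y == y1] &, injective F}.
  move=> p p' /setIdP[pe /eqP py] /setIdP[pe' /eqP py'].
  move=> /ffunP E; apply/ffunP => z; move: (E z); rewrite !ffunE.
  by apply: (biso_inj bc); apply: val.
rewrite -(card_in_imset injF); apply: subset_leq_card; apply/subsetP.
move=> _ /imsetP[p /setIdP[pe /eqP py] ->]; apply/setIdP; split; last first.
  by rewrite ffunE py (biso_root bc).
have xy1 := near _ pe py; case/embP: pe => b out.
apply/embP; split=> [|z zr]; last by rewrite !ffunE out.
have bc' : biso r (p x) (chi (p x)) chi.
  by apply: (biso_sub bc xy1); rewrite addnC.
have /sisoP[h1 h2 h3 h4] := siso_comp b bc'.
rewrite ffunE; apply/sisoP; split.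
- by move=> a c ar cr; rewrite !ffunE; apply: h1.
- by rewrite -h2; apply: eq_imset => a; rewrite ffunE.
- by move=> a c ar cr; rewrite !ffunE; apply: h3.
- by move=> a ar; rewrite ffunE; apply: h4.
Qed.

(** By [card_emb_through], the number of embeddings sending [y] to [v] depends only on the type of
    [v] at radius [r + k]; [sum_avg_adj] then applies. *)
Lemma sum_emb_avg r x y k (f : G -> R) : y \in ball_set x k -> (k <= r)%N ->
  \sum_(phi in emb r x) f (phi y) =
  \sum_(phi in emb r x)
     avg (ball_type d (r + k) (G := G)) f (ball_type d (r + k) (phi y)).
Proof.
move=> yx kr; pose m v : R := #|[set phi in emb r x | phi y == v]|%:R.
have S F : \sum_(phi in emb r x) F (phi y) = \sum_v m v * F v :> R.
  rewrite (partition_big (fun phi : {ffun H -> G} => phi y) xpredT) //=.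
  apply: eq_bigr => v _.
  rewrite (eq_bigr (fun=> F v)) => [|phi /andP[_ /eqP -> //]].
  rewrite sumr_const -[LHS]mulr_natl /m; congr (_%:R * _).
  by apply: eq_card => phi; rewrite [RHS]inE.
rewrite !S (S (fun v => avg _ f (ball_type d (r + k) v))) sum_avg_adj //.
by move=> v w vw; congr _%:R; apply/eqP; rewrite eqn_leq !(card_emb_through (k := k)).
Qed.

Lemma sum_emb_avg_root r x (f : G -> R) :
  \sum_(phi in emb r x) f (phi x) =
  #|emb r x|%:R * avg (ball_type d r (G := G)) f (ball_type d r x).
Proof.
rewrite (sum_emb_avg (k := 0) f (root_in_ball x 0)) // addn0.
rewrite -[RHS]mulrC mulr_natr -sumr_const; apply: eq_bigr => phi pe.
by rewrite (emb_type pe (root_in_ball x 0)).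
Qed.

End Embeddings.

(** * Expected labels of randomly lifted vertices *)

Section Transfer.
Variables (R : realFieldType) (d : nat) (G H : sgraph).
Hypotheses (dG : max_degree d G) (dH : max_degree d H).
Variables (rt : H -> H) (K s : nat).
Hypothesis rt_ball : forall y, y \in ball_set (rt y) K.
Hypothesis rt_card : forall x, (#|[set y | rt y == x]| <= K)%N.
Variable rho : R.
Hypothesis rho0 : 0 <= rho.

Local Notation emb := (@ball_embeddings H G (s + K)).
Local Notation tG r := (ball_type d r (G := G)).
Local Notation tH r := (ball_type d r (G := H)).

(** In this section [K] bounds the classes of [rt], which will be the large pieces of [H]. A common
    type at the root guarantees that embeddings exist. *)
Definition kept (y : H) : bool :=
  common (tG (s + K)) (tH (s + K)) rho (tH (s + K) (rt y)).

Definition lift_mean (f : G -> R) (y : H) : R :=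
  (\sum_(phi in emb (rt y)) f (phi y)) / #|emb (rt y)|%:R.

Lemma common_emb x : common (tG (s + K)) (tH (s + K)) rho (tH (s + K) x) ->
  (0 < #|emb x|)%N.
Proof.
have H0 : (0 < #|fiber (tH (s + K)) (tH (s + K) x)|)%N.
  by apply/card_gt0P; exists x; rewrite inE.
rewrite /common; case: (posnP #|fiber (tG (s + K)) (tH (s + K) x)|) => [->|].
  by rewrite mulr0 lern0 => /eqP E; rewrite E in H0.
by case/card_gt0P => x'; rewrite inE => /eqP E _; apply: (emb_neq0 dG dH (x' := x')).
Qed.

Lemma card_unkept :
  #|[set y | ~~ kept y]|%:R <= K%:R * (2 * discrepancy (tG (s + K)) (tH (s + K)) rho).
Proof.
set U := [set x | ~~ common (tG (s + K)) (tH (s + K)) rho (tH (s + K) x)].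
apply: le_trans (_ : (K * #|U|)%N%:R <= _); last first.
  by rewrite natrM ler_wpM2l ?ler0n // card_uncommon.
rewrite ler_nat.
have sub : [set y | ~~ kept y] \subset \bigcup_(x in U) [set y | rt y == x].
  apply/subsetP => y; rewrite inE => ky; apply/bigcupP; exists (rt y); rewrite inE //.
apply: leq_trans (subset_leq_card sub) _.
apply: leq_trans (leq_card_bigcup _ _) _.
by rewrite mulnC -sum_nat_const leq_sum.
Qed.

(** The outer radius is the one at which the type of the image fixes its weight; the inner one is a
    radius at which embeddings preserve the type of every vertex of the class. *)
Definition drift (f : G -> R) (v : G) : R :=
  avg (tG (s + K + K)) f (tG (s + K + K) v) - avg (tG s) f (tG s v).

(** By [sum_emb_avg], [f] may be replaced by its average at the outer radius. The average at the
    inner radius takes the same value at [y] and at all its images, and the drift bounds the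
    difference. *)
Lemma lift_mean_ge f y : kept y ->
  avg (tG s) f (tH s y) - lift_mean (fun v => `|drift f v|) y <= lift_mean f y.
Proof.
move=> /common_emb N0; rewrite /lift_mean.
have N0' : 0 < #|emb (rt y)|%:R :> R by rewrite ltr0n.
rewrite (sum_emb_avg dG f (rt_ball y) (leq_addl s K)).
rewrite ler_pdivlMr // mulrBl divfK ?lt0r_neq0 // lerBlDr -big_split /=.
rewrite mulrC mulr_natl -sumr_const; apply: ler_sum => phi pe.
have := @emb_type d _ _ _ _ _ _ _ s pe (rt_ball y); rewrite addnC leqnn => /(_ isT) <-.
have := ler_norm (- drift f (phi y)); rewrite normrN /drift => ?; lra.
Qed.

(** Grouped by root, the values of [g] over an embedded class are at most its sum [h] over a ball of
    radius [K] around the image of the root. Only the average of [h] at the type of the root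
    remains, and each [v] lies in at most [d.+1 ^ K] such balls. *)
Lemma sum_lift_mean (g : G -> R) : (forall v, 0 <= g v) ->
  \sum_(y | kept y) lift_mean g y <= 2 * rho * ((d.+1 ^ K)%:R * \sum_v g v).
Proof.
move=> g0; pose h x' := \sum_(v in ball_set x' K) g v.
have -> : \sum_(y | kept y) lift_mean g y =
    \sum_(x | common (tG (s + K)) (tH (s + K)) rho (tH (s + K) x))
      (\sum_(phi in emb x) \sum_(y | rt y == x) g (phi y)) / #|emb x|%:R.
  rewrite (partition_big rt
    (fun x => common (tG (s + K)) (tH (s + K)) rho (tH (s + K) x))) //=.
  apply: eq_bigr => x cx; rewrite exchange_big /= mulr_suml.
  apply: eq_big => [y|y /andP[_ /eqP <-]] //.
  by rewrite /kept; case: eqP => [->|]; rewrite ?andbF // cx.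
apply: le_trans (_ : \sum_(x | common (tG (s + K)) (tH (s + K)) rho (tH (s + K) x))
    avg (tG (s + K)) h (tH (s + K) x) <= _).
  apply: ler_sum => x cx; have N0 := common_emb cx.
  rewrite ler_pdivrMr ?ltr0n // mulrC -(sum_emb_avg_root dG).
  apply: ler_sum => phi /embP[b _].
  have sub : [set y | rt y == x] \subset ball_set x K.
    by apply/subsetP => y; rewrite inE => /eqP <-.
  have bK : biso K x (phi x) phi.
    by apply: (biso_sub b (root_in_ball x 0)); rewrite leq_addl.
  rewrite /h -(biso_im bK) (big_imset _ (biso_inj bK)) /=.
  rewrite (eq_bigl (fun y => y \in [set y | rt y == x])); last by move=> y; rewrite inE.
  exact: (ler_sum_subset (fun v => g0 (phi v)) sub).
apply: le_trans (sum_common_avg _ _ rho0 _) _ => [x|]; first exact: sumr_ge0.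
rewrite ler_wpM2l ?mulr_ge0 // /h.
rewrite (exchange_big_dep xpredT) //= mulr_sumr; apply: ler_sum => v _.
rewrite sumr_const -[leLHS]mulr_natl ler_wpM2r // ler_nat.
apply: leq_trans (card_ball v K dG); apply: eq_leq; apply: eq_card => x.
by rewrite -mem_ball_sym.
Qed.

Lemma lift_mean_transfer (f : G -> R) : (forall v, 0 <= f v <= 1) ->
  rho * \sum_v f v - discrepancy (tG s) (tH s) rho
   - K%:R * (2 * discrepancy (tG (s + K)) (tH (s + K)) rho)
   - 2 * rho * ((d.+1 ^ K)%:R * \sum_v `|drift f v|)
  <= \sum_(y | kept y) lift_mean f y.
Proof.
move=> f01.
have h1 := sum_avg_transfer (tG s) (tH s) rho f01.
have h2 : \sum_y avg (tG s) f (tH s y) <=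
    \sum_(y | kept y) avg (tG s) f (tH s y) + #|[set y | ~~ kept y]|%:R.
  rewrite (bigID kept) /= lerD2l.
  apply: le_trans (_ : \sum_(y | ~~ kept y) 1 <= _).
    by apply: ler_sum => y _; apply: avg_le1 => v; case/andP: (f01 v).
  by rewrite sumr_const ler_nat; apply: eq_leq; apply: eq_card => y; rewrite !inE.
have h3 : \sum_(y | kept y) avg (tG s) f (tH s y)
    - \sum_(y | kept y) lift_mean (fun v => `|drift f v|) y
    <= \sum_(y | kept y) lift_mean f y.
  by rewrite -sumrB; apply: ler_sum => y; apply: lift_mean_ge.
have h4 := sum_lift_mean (fun v => normr_ge0 (drift f v)).
have h5 := card_unkept.
lra.
Qed.

End Transfer.

(** * Frequencies of ball types *)

From mathcomp Require Import all_classical all_reals all_analysis.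
(* Restores the names of [finset] shadowed by those of [classical_sets]. *)
From mathcomp Require Import fintype finset.
Import numFieldNormedType.Exports.

Lemma rooted_isoP (G H : sgraph) (r : nat) (x : G) (y : H) :
  rooted_iso (rball x r) (rball y r) <-> exists f, biso r x y f.
Proof.
split=> [[F [bF aF rF]]|[f b]].
  pose f z := if insub z is Some u then val (F u) else y.
  have fE z (zr : z \in ball_set x r) : f z = val (F (exist _ z zr)).
    by rewrite /f insubT.
  exists f; apply/sisoP; split.
  - move=> z w zr wr; rewrite (fE _ zr) (fE _ wr) => /val_inj/(bij_inj bF) e.
    exact: (congr1 val e).
  - apply/setP => z; apply/imsetP/idP => [[w wr ->]|zr].
      by rewrite (fE _ wr); apply: valP.
    case: bF => F' _ F'K; exists (val (F' (exist _ z zr))); first exact: valP.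
    by rewrite /f valK F'K.
  - by move=> z w zr wr; rewrite (fE _ zr) (fE _ wr); apply: aF.
  move=> z zr; rewrite (fE _ zr) /=.
  have : (F (exist _ z zr) == rg_root (rball y r)) = (z == x).
    by rewrite -rF (inj_eq (bij_inj bF)) -val_eqE.
  by rewrite -val_eqE.
have fr (u : rball x r) : f (val u) \in ball_set y r.
  by rewrite -(biso_im b) imset_f //; apply: valP.
exists (fun u => exist _ (f (val u)) (fr u)); split.
- apply: inj_card_bij => [u v /(congr1 val) /= e|].
    by apply: val_inj; apply: (biso_inj b) e; apply: valP.
  by rewrite !card_sig -(biso_im b) leq_imset_card.
- by move=> u v /=; apply: (biso_adj b); apply: valP.
by apply: val_inj; rewrite /= (biso_root b).
Qed.

Section BallRadius.
Variables (d : nat) (G : sgraph).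
Implicit Types (x : G) (r s : nat).

Lemma max_degree_rball x r : max_degree d G -> max_degree d (rball x r).
Proof.
move=> dG u; apply: leq_trans (dG (val u)).
rewrite -(card_imset _ val_inj); apply/subset_leq_card/subsetP.
by move=> _ /imsetP[v + ->]; rewrite !inE.
Qed.

Lemma rball_ball_set x r s (u : rball x r) : (s <= r)%N ->
  (u \in ball_set (rg_root (rball x r)) s) = (val u \in ball_set x s).
Proof.
elim: s u => [|s IH] u sr; first by rewrite !in_ball0 -val_eqE.
apply/in_ballSP/in_ballSP => [[e|[v vs vu]]|[e|[z zs zu]]].
- by left; rewrite e.
- by right; exists (val v) => //; rewrite -IH // ltnW.
- by left; apply: val_inj.
have zr : z \in ball_set x r by apply: (subsetP (sub_ball x (ltnW sr))).
by right; exists (exist _ z zr) => //; rewrite IH // ltnW.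
Qed.

(** If the ball still grows at its last step, some vertex is at distance exactly [r] from the
    root. *)
Lemma has_radius_rball x r :
  (forall s, r = s.+1 -> ~~ (ball_set x s.+1 \subset ball_set x s)) ->
  has_radius (rball x r) r.
Proof.
move=> nc; split=> [u|s us].
  have := rball_ball_set u (leqnn r); rewrite inE => ->; exact: valP.
case: r nc us => // r /(_ r erefl) nc us; rewrite ltnNge; apply: contra nc => sr.
apply/subsetP => z zr; apply: (subsetP (sub_ball x sr)).
have := us (exist _ z zr).
by have := rball_ball_set (exist _ z zr : rball x r.+1) (leqW sr); rewrite inE => ->.
Qed.

End BallRadius.

Section CauchySeq.
Variable R : realType.
Implicit Types (u v : nat -> R).

Definition cauchy_real u : Prop := forall e : R, 0 < e -> exists N : nat,
  forall m n, (N <= m)%N -> (N <= n)%N -> `|u m - u n| <= e.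

Lemma cvg_cauchy_real u : cvg (u @ \oo)%classic -> cauchy_real u.
Proof.
move=> cu e e0.
have e20 : 0 < e / 2 by rewrite divr_gt0.
have /cvgrPdist_le/(_ _ e20)[N _ hN] := cu.
exists N => m n Nm Nn; have := hN m Nm; have := hN n Nn => /=.
set l := lim _ => hn hm.
rewrite (_ : u m - u n = (l - u n) - (l - u m)); last by ring.
by apply: le_trans (ler_normB _ _) _; lra.
Qed.

Lemma cauchy_real0 : cauchy_real (fun=> 0).
Proof. by move=> e e0; exists 0%N => m n _ _; rewrite subrr normr0 ltW. Qed.

Lemma cauchy_realD u v : cauchy_real u -> cauchy_real v ->
  cauchy_real (fun n => u n + v n).
Proof.
move=> cu cv e e0; have e20 : 0 < e / 2 by rewrite divr_gt0.
have [N hN] := cu _ e20; have [M hM] := cv _ e20.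
exists (maxn N M) => m n; rewrite !geq_max => /andP[Nm Mm] /andP[Nn Mn].
rewrite (_ : _ - _ = (u m - u n) + (v m - v n)); last by ring.
have := hN _ _ Nm Nn; have := hM _ _ Mm Mn.
by move=> h1 h2; apply: le_trans (ler_normD _ _) _; lra.
Qed.

Lemma cauchy_realN u : cauchy_real u -> cauchy_real (fun n => - u n).
Proof.
move=> cu e /cu[N hN]; exists N => m n Nm Nn.
by rewrite -opprD normrN hN.
Qed.

Lemma cauchy_real_sum (I : finType) (u : I -> nat -> R) :
  (forall i, cauchy_real (u i)) -> cauchy_real (fun n => \sum_i u i n).
Proof.
move=> cu; elim: (index_enum I) => [|i s IH].
  by rewrite (_ : (fun _ => _) = fun=> 0);
    [exact: cauchy_real0 | apply: funext => n; rewrite big_nil].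
rewrite (_ : (fun _ => _) = fun n => u i n + \sum_(j <- s) u j n).
  exact: cauchy_realD.
by apply: funext => n; rewrite big_cons.
Qed.

End CauchySeq.

Section TypeFrequency.
Variables (R : realType) (d : nat) (G : nat -> sgraph).
Hypothesis dG : forall n, max_degree d (G n).
Hypothesis Gweak : weakly_convergent R d G.

Definition type_freq r (t : gcode (d.+1 ^ r)) (n : nat) : R :=
  #|fiber (@ball_type d r (G n)) t|%:R / #|G n|%:R.

Definition stable_ball (H : sgraph) (s : nat) (x : H) : bool :=
  ball_set x s.+1 \subset ball_set x s.

Lemma stable_ballE (H : sgraph) s (x : H) :
  stable_ball s x = (#|ball_set x s.+1| == #|ball_set x s|).
Proof.
have ss := sub_ball x (leqnSn s); rewrite /stable_ball.
by rewrite eqn_leq (subset_leq_card ss) andbT (geq_leqif (subset_leqif_card ss)).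
Qed.

(** Stability is an equality between the sizes of two balls, both read off from the larger type. *)
Lemma ball_type_closed (H H' : sgraph) s (x : H) (y : H') :
  max_degree d H -> max_degree d H' ->
  ball_type d s.+1 x = ball_type d s.+1 y -> stable_ball s x = stable_ball s y.
Proof.
move=> dH dH' /(ball_type_biso dH dH')[f b]; rewrite !stable_ballE.
have E k : (k <= s.+1)%N -> #|ball_set y k| = #|ball_set x k|.
  move=> ks; have bk := biso_sub b (root_in_ball x 0) ks.
  rewrite -(biso_root b) -(biso_im bk) card_in_imset //.
  exact: (biso_inj bk).
by rewrite !E.
Qed.

Lemma stable_ball_type (H H' : sgraph) s (x : H) (y : H') :
  max_degree d H -> max_degree d H' -> stable_ball s x -> stable_ball s y ->
  ball_type d s x = ball_type d s y -> ball_type d s.+1 x = ball_type d s.+1 y.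
Proof.
move=> dH dH' cx cy /(ball_type_biso dH dH')[f b].
have E (K : sgraph) (z : K) : stable_ball s z -> ball_set z s.+1 = ball_set z s.
  by move=> cz; apply/eqP; rewrite eqEsubset; apply/andP; split; [exact: cz | exact: sub_ball].
by apply: (@biso_ball_type _ _ _ _ _ _ f); rewrite /biso !E.
Qed.

Lemma cauchy_type_freq_radius r n0 (x0 : G n0) :
  has_radius (rball x0 r) r -> cauchy_real (type_freq (ball_type d r x0)).
Proof.
move=> hr; have := cvg_cauchy_real (Gweak hr (max_degree_rball (@dG n0))).
rewrite (_ : (fun n => ball_freq R (G n) r (rball x0 r)) = type_freq (ball_type d r x0)) //.
apply: funext => n; rewrite /ball_freq /type_freq; congr (_%:R / _).
apply: eq_card => x; rewrite !inE; apply/asboolP/eqP.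
  by case/rooted_isoP => f; apply: biso_ball_type.
by move/(ball_type_biso (@dG n) (@dG n0)) => ex; apply/rooted_isoP.
Qed.

Lemma cauchy_type_freq_absent r (t : gcode (d.+1 ^ r)) :
  ~ (exists n (x : G n), ball_type d r x = t) -> cauchy_real (type_freq t).
Proof.
move=> none; rewrite (_ : type_freq t = fun=> 0); first exact: cauchy_real0.
apply: funext => n; rewrite /type_freq (_ : fiber _ _ = set0).
  by rewrite cards0 mul0r.
apply/setP => x; rewrite !inE; apply/negbTE/eqP => xt.
by apply: none; exists n, x.
Qed.

(* The hypothesis only concerns types of full radius.  If the ball around [x0]
   stops growing at radius [s], the vertices of its type at radius [s.+1] are
   those of its type at radius [s], minus those whose ball still grows; the
   latter are classified by finitely many types of full radius. *)
Lemma cauchy_type_freq r (t : gcode (d.+1 ^ r)) : cauchy_real (type_freq t).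
Proof.
elim: r t => [|s IH] t.
  have [[n0 [x0 <-]]|] := EM (exists n0 (x0 : G n0), ball_type d 0 x0 = t).
    by apply: cauchy_type_freq_radius; apply: has_radius_rball.
  exact: cauchy_type_freq_absent.
have [[n0 [x0 x0t]]|] := EM (exists n0 (x0 : G n0), ball_type d s.+1 x0 = t);
  last exact: cauchy_type_freq_absent.
have [cx0|ncx0] := boolP (stable_ball s x0); last first.
  rewrite -x0t; apply: cauchy_type_freq_radius; apply: has_radius_rball.
  by move=> s' [<-].
pose M t' n : R := #|[set x : G n | [&& ball_type d s.+1 x == t',
  ball_type d s x == ball_type d s x0 & ~~ stable_ball s x]]|%:R / #|G n|%:R.
rewrite (_ : type_freq t = fun n => type_freq (ball_type d s x0) n + - \sum_t' M t' n).
  apply: cauchy_realD; first exact: IH.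
  apply: cauchy_realN; apply: cauchy_real_sum => t'.
  (* Type [t'] decides both the smaller type and stability, so [M t'] is either a frequency of a
     type of full radius or identically 0. *)
  have [[n1 [x1 [<- e1 nc1]]]|none] := EM (exists n1 (x1 : G n1),
     [/\ ball_type d s.+1 x1 = t', ball_type d s x1 = ball_type d s x0
       & ~~ stable_ball s x1]).
    rewrite (_ : M _ = type_freq (ball_type d s.+1 x1)).
      by apply: cauchy_type_freq_radius; apply: has_radius_rball => s' [<-].
    apply: funext => n; rewrite /M /type_freq; congr (_%:R / _).
    apply: eq_card => x; rewrite !inE; case: eqP => //= xx1.
    rewrite (ball_type_closed (@dG n) (@dG n1) xx1) nc1 andbT -e1.
    by apply/eqP; apply: ball_type_le xx1.
  rewrite (_ : M t' = fun=> 0); first exact: cauchy_real0.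
  apply: funext => n; rewrite /M (_ : [set x | _]%SET = set0).
    by rewrite cards0 mul0r.
  apply/setP => x; rewrite !inE; apply/negbTE/and3P => -[/eqP h1 /eqP h2 h3].
  by apply: none; exists n, x.
apply: funext => n; rewrite -mulr_suml /type_freq -mulrBl; congr (_ / _).
apply/eqP; rewrite eq_sym subr_eq -natr_sum -natrD; apply/eqP; congr _%:R.
rewrite -(cardsID [set x : G n | stable_ball s x]); congr (_ + _)%N.
  apply: eq_card => x; rewrite !inE -x0t; apply/andP/eqP => [[/eqP e cx]|e].
    exact: (stable_ball_type (@dG n) (@dG n0)).
  rewrite (ball_type_closed (@dG n) (@dG n0) e) cx0; split=> //.
  by apply/eqP; apply: ball_type_le e.
rewrite -sum1_card (partition_big (@ball_type d s.+1 (G n)) xpredT) //=.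
apply: eq_bigr => t' _; rewrite sum1dep_card; apply: eq_card => x.
by rewrite !inE andbC; congr (_ && _); rewrite andbC.
Qed.

(** There are finitely many types at radii below [r0]; at each radius the tolerance is shared
    equally among them. *)
Lemma discrepancy_small (r0 : nat) (beta : R) : (forall n, 0 < #|G n|)%N ->
  0 < beta -> exists N, forall m n, (N <= m)%N -> (N <= n)%N ->
  forall r, (r < r0)%N ->
  discrepancy (@ball_type d r (G m)) (@ball_type d r (G n))
    (#|G n|%:R / #|G m|%:R) <= beta * #|G n|%:R.
Proof.
move=> Gn0 b0; elim: r0 => [|r0 [N hN]]; first by exists 0%N.
set T := gcode (d.+1 ^ r0).
have c0 : 0 < beta / #|T|%:R.
  by rewrite divr_gt0 // ltr0n; apply/card_gt0P; exists (set0, set0, set0).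
have [M hM] : exists M, forall (t : T) m n, (M <= m)%N -> (M <= n)%N ->
    `|type_freq t m - type_freq t n| <= beta / #|T|%:R.
  have [M hM] := choice (fun t : T => cauchy_type_freq t c0).
  exists (\max_t M t)%N => t m n Mm Mn; apply: hM.
    exact: leq_trans (leq_bigmax t) Mm.
  exact: leq_trans (leq_bigmax t) Mn.
exists (maxn N M) => m n; rewrite !geq_max => /andP[Nm Mm] /andP[Nn Mn] r.
rewrite ltnS leq_eqVlt => /orP[/eqP ->|]; last exact: hN.
apply: le_trans (_ : \sum_(t : T) #|G n|%:R * (beta / #|T|%:R) <= _); last first.
  rewrite sumr_const -[leLHS]mulr_natr.
  have T0 : #|T|%:R != 0 :> R by move: c0; apply: contraTneq => ->; rewrite invr0 mulr0 ltxx.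
  by rewrite -mulrA divfK // mulrC.
apply: ler_sum => t _.
have n0 : 0 < #|G n|%:R :> R by rewrite ltr0n.
have m0 : 0 < #|G m|%:R :> R by rewrite ltr0n.
have h := hM t m n Mm Mn; rewrite -(ler_pM2l n0) in h; apply: (le_trans _ h) => {h}.
rewrite -[X in X * `|_|]gtr0_norm // -normrM distrC /type_freq le_eqVlt.
by apply/orP; left; apply/eqP; congr `| _ |; field; rewrite !lt0r_neq0.
Qed.

End TypeFrequency.

(** * Strong convergence *)

Lemma sum_modn (F : nat -> nat) (k n : nat) :
  (\sum_(0 <= i < k * n) F (i %% n) = k * \sum_(0 <= i < n) F i)%N.
Proof.
elim: k => [|k IH]; first by rewrite !mul0n big_geq.
rewrite !mulSn (@big_cat_nat _ _ _ n) ?leq_addr //=; congr (_ + _)%N.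
  by apply: eq_big_nat => i /andP[_ lin]; rewrite modn_small.
rewrite -{1}[n]add0n big_addn addKn -IH.
by apply: eq_bigr => i _; rewrite modnDr.
Qed.

(** Cycling through [A] visits each element equally often, a deterministic substitute for a uniform
    random choice. *)
Lemma sum_nth_modn (T : finType) (A : {set T}) (x0 : T) (F : T -> nat) (p : nat) :
  (#|A| %| p)%N ->
  ((\sum_(i < p) F (nth x0 (enum A) (i %% #|A|))) * #|A| = p * \sum_(a in A) F a)%N.
Proof.
case/dvdnP => k ->; rewrite -(big_mkord xpredT (fun i => F (nth x0 (enum A) (i %% #|A|)))).
rewrite (sum_modn (fun i => F (nth x0 (enum A) i))) mulnAC; congr (_ * _)%N.
by rewrite -big_enum /= (big_nth x0) -cardE.
Qed.

Section PairDistance.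
Variables (R : realType) (d : nat) (G H : sgraph) (K L s : nat).
Variables (C : G -> {set G}) (Q : H -> {set H}).
Hypotheses (dG : max_degree d G) (dH : max_degree d H).
Hypotheses (pC : pieces K C) (pQ : pieces L Q) (Ks : (K < s)%N).
Variable g0 : G.

(** The choice depends only on the set [Q y], so a whole piece shares its root. *)
Definition piece_root (y : H) : H := odflt y [pick z in Q y].

Lemma piece_root_mem y : piece_root y \in Q y.
Proof.
rewrite /piece_root; case: pickP => [z //|/(_ y)].
by rewrite (piece_refl pQ).
Qed.

Lemma piece_root_eq y z : z \in Q y -> piece_root z = piece_root y.
Proof.
move=> zy; rewrite /piece_root (piece_eq pQ zy).
by case: pickP => // /(_ y); rewrite (piece_refl pQ).
Qed.

Lemma piece_root_ball y : y \in ball_set (piece_root y) L.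
Proof.
rewrite mem_ball_sym; apply: (subsetP (piece_ball pQ y)); exact: piece_root_mem.
Qed.

Lemma card_piece_root x : (#|[set y | piece_root y == x]| <= L)%N.
Proof.
apply: leq_trans (card_piece pQ x); apply/subset_leq_card/subsetP => y.
rewrite inE => /eqP <-.
by rewrite (piece_eq pQ (piece_root_mem y)) (piece_refl pQ).
Qed.

Local Notation emb := (@ball_embeddings H G (s + L)).

(** A common multiple of all nonzero numbers of embeddings; [maxn 1] keeps roots without embeddings
    from annihilating it. The factors [#|G|] and [#|H|] in [p] and [q] equalize the numbers of
    vertices. *)
Definition copies_factor : nat := \prod_(x : H) (maxn 1 #|emb x|).
Local Notation p := (#|G| * copies_factor)%N.
Local Notation q := (#|H| * copies_factor)%N.

Lemma copies_factor_gt0 : (0 < copies_factor)%N.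
Proof. by apply: prodn_gt0 => x; rewrite leq_max. Qed.

Definition chosen_emb (i : 'I_p) (x : H) : {ffun H -> G} :=
  nth [ffun=> g0] (enum (emb x)) (i %% #|emb x|).

Lemma emb_dvdn x : (0 < #|emb x|)%N -> (#|emb x| %| p)%N.
Proof.
move=> N0; apply/dvdn_mull; rewrite /copies_factor (bigD1 x) //=.
by apply: dvdn_mulr; rewrite (maxn_idPr N0).
Qed.

Let rho : R := #|H|%:R / #|G|%:R.

Let kept_root (x : H) : bool :=
  common (ball_type d (s + L) (G := G)) (ball_type d (s + L) (G := H)) rho
    (ball_type d (s + L) x).

(** Over the [p] copies each embedding at a kept root is chosen equally often, so counts are exactly
    [p] times expectations. *)
Lemma card_chosen (a : pred G) :
  #|[set w : copies p H | kept_root (piece_root w.2)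
      && a (vlift piece_root chosen_emb w)]|%:R =
  p%:R * \sum_(y | kept d G piece_root L s rho y)
           lift_mean piece_root L s (fun v => (a v)%:R) y :> R.
Proof.
rewrite -sum1dep_card big_mkcondr /= mulr_sumr.
rewrite -(pair_big_dep xpredT (fun _ y => kept_root (piece_root y))
  (fun i y => if a (chosen_emb i (piece_root y) y) then 1 else 0)%N) /=.
rewrite (exchange_big_dep (fun y => kept_root (piece_root y))) //=.
rewrite natr_sum; apply: eq_bigr => y ky.
have N0 := common_emb dG dH ky.
have N0' : #|emb (piece_root y)|%:R != 0 :> R by rewrite pnatr_eq0 -lt0n.
apply: (mulIf N0'); rewrite /lift_mean mulrA divfK //.
rewrite -natr_sum -!natrM.
rewrite -(sum_nth_modn [ffun=> g0] (fun phi => nat_of_bool (a (phi y))) (emb_dvdn N0)).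
congr (_ * _)%:R; apply: eq_big => [i|i _]; first exact: ky.
by rewrite /chosen_emb; case: (a _).
Qed.

Variables beta eta : R.
Hypotheses (beta0 : 0 <= beta) (eta0 : 0 <= eta).
Hypothesis disc_s : discrepancy (ball_type d s (G := G)) (ball_type d s (G := H)) rho
  <= beta * #|H|%:R.
Hypothesis disc_sL : discrepancy (ball_type d (s + L) (G := G))
  (ball_type d (s + L) (G := H)) rho <= beta * #|H|%:R.
Hypothesis drift_small : forall c,
  \sum_v `|drift d L s (fun w => (piece_code K C w == c)%:R) v| <= eta * #|G|%:R.

(** The three terms account for the touching vertices of [G], the shallow vertices of [H], and the
    deficit of each code among the lifts, bounded by [lift_mean_transfer]. *)
Lemma exists_matching : (0 < #|H|)%N ->
  exists2 g : {ffun copies q G -> copies p H}, injective g &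
  delta R (copies q G) (pullback g (copies p H)) <=
    #|touching C|%:R / #|G|%:R + (#|touching Q| * d.+1 ^ K)%N%:R / #|H|%:R
    + #|gcode K|%:R * (beta + 2 * L%:R * beta + 2 * (d.+1 ^ L)%:R * eta).
Proof.
move=> H0; have G0 : (0 < #|G|)%N by apply/card_gt0P; exists g0.
have rho0 : 0 <= rho by rewrite divr_ge0 ?ler0n.
have [|||g ginj gle] := @matching_with_lift G H K L (s + L) p C Q pC pQ
    piece_root kept_root chosen_emb piece_root_ball piece_root_eq _ _ q.
- by rewrite addnC leq_add2r.
- move=> i y ky; have N0 := common_emb dG dH ky.
  suff /embP[] : chosen_emb i (piece_root y) \in emb (piece_root y) by [].
  by rewrite -mem_enum mem_nth // -cardE ltn_mod.
- by rewrite mulnAC [RHS]mulnAC [(#|H| * _)%N]mulnC.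
exists g => //.
have cf0 : 0 < copies_factor%:R :> R by rewrite ltr0n copies_factor_gt0.
have G0' : 0 < #|G|%:R :> R by rewrite ltr0n.
have H0' : 0 < #|H|%:R :> R by rewrite ltr0n.
rewrite /delta ler_pdivrMr; last first.
  by rewrite ltr0n card_prod card_ord !muln_gt0 H0 G0 copies_factor_gt0.
have -> : #|copies q G|%:R = #|H|%:R * copies_factor%:R * #|G|%:R :> R.
  by rewrite card_prod card_ord !natrM.
have {gle} := gle; rewrite -(ler_nat R) => /le_trans; apply.
rewrite !natrD !natrM mulrDl mulrDl; apply: lerD; first apply: lerD.
- by rewrite le_eqVlt; apply/orP; left; apply/eqP; field; rewrite lt0r_neq0.
- have sh : #|shallow Q K|%:R <= #|touching Q|%:R * (d.+1 ^ K)%:R :> R.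
    by rewrite -natrM ler_nat (card_shallow K dH pQ).
  rewrite [leRHS](_ : _ = #|G|%:R * copies_factor%:R * (#|touching Q|%:R * (d.+1 ^ K)%:R)).
    by rewrite ler_wpM2l // mulr_ge0 // ltW.
  by field; rewrite lt0r_neq0.
rewrite natr_sum.
set B := beta + _ + _.
have B0 : 0 <= B.
  by rewrite /B !addr_ge0 // !mulr_ge0.
apply: le_trans (_ : \sum_(c : gcode K) B * (#|H|%:R * copies_factor%:R * #|G|%:R) <= _);
    last by rewrite sumr_const -[leLHS]mulr_natl mulrA.
apply: ler_sum => c _.
set a := #|[set x | _ == c]|; set N := #|_|.
have E : N%:R = p%:R * _ := card_chosen (fun v => piece_code K C v == c).
have T := lift_mean_transfer dG dH s piece_root_ball card_piece_root rho0
  (f := fun v => (piece_code K C v == c)%:R).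
have sa : \sum_v (piece_code K C v == c)%:R = a%:R :> R.
  by rewrite -natr_sum /a -sum1dep_card [in RHS]big_mkcond.
have {}T : rho * a%:R - B * #|H|%:R <=
    \sum_(y | kept d G piece_root L s rho y)
      lift_mean piece_root L s (fun v => (piece_code K C v == c)%:R) y.
  apply: le_trans (T _); last by move=> v; case: (_ == _); rewrite ?lexx ?ler01.
  rewrite sa.
  have dL0 : 0 <= (d.+1 ^ L)%:R :> R by rewrite ler0n.
  have L0 : 0 <= L%:R :> R by rewrite ler0n.
  have h1 := ler_wpM2l L0 disc_sL.
  have h2 : 2 * rho * ((d.+1 ^ L)%:R *
      \sum_v `|drift d L s (fun w => (piece_code K C w == c)%:R) v|) <=
      2 * (d.+1 ^ L)%:R * eta * #|H|%:R.
    apply: le_trans (_ : 2 * rho * ((d.+1 ^ L)%:R * (eta * #|G|%:R)) <= _).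
      by apply: ler_wpM2l; [rewrite mulr_ge0 | apply: ler_wpM2l].
    by rewrite le_eqVlt; apply/orP; left; apply/eqP; rewrite /rho; field; rewrite lt0r_neq0.
  by move: disc_s h1 h2; rewrite /B; lra.
(* Without a deficit the truncated difference vanishes; otherwise it is a true difference. *)
have [qN|Nq] := leqP (q * a)%N N.
  by rewrite (eqP (_ : q * a - N == 0)%N) ?subn_eq0 // mulr_ge0 // !mulr_ge0.
rewrite natrB ?(ltnW Nq) // E !natrM.
have := ler_wpM2l (_ : 0 <= #|G|%:R * copies_factor%:R) T.
rewrite mulr_ge0 ?ler0n // => /(_ isT).
have -> : #|G|%:R * copies_factor%:R * (rho * a%:R - B * #|H|%:R) =
   #|H|%:R * copies_factor%:R * a%:R - B * (#|H|%:R * copies_factor%:R * #|G|%:R).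
  by rewrite /rho; field; rewrite lt0r_neq0.
by move=> ?; lra.
Qed.

Lemma delta_rho_le : (0 < #|H|)%N ->
  delta_rho R G H <=
    #|touching C|%:R / #|G|%:R + (#|touching Q| * d.+1 ^ K)%N%:R / #|H|%:R
    + #|gcode K|%:R * (beta + 2 * L%:R * beta + 2 * (d.+1 ^ L)%:R * eta).
Proof.
move=> H0; have G0 : (0 < #|G|)%N by apply/card_gt0P; exists g0.
have [g ginj gle] := exists_matching H0.
rewrite /delta_rho !eqn0Ngt G0 H0 eqxx /=; apply: le_trans gle.
apply: (@le_trans _ _ (deltaS R (copies q G) (copies p H))).
  (* The infimum is over a set bounded below by 0. *)
  apply: ge_inf.
    exists 0 => _ [p' [q' [_ _ _ ->]]].
    rewrite /deltaS; apply: le_bigmin => // g' _.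
    by rewrite divr_ge0.
  exists p, q; split=> //; rewrite ?muln_gt0 ?G0 ?H0 ?copies_factor_gt0 //.
  by rewrite mulnAC [RHS]mulnAC [(#|H| * _)%N]mulnC.
by apply: bigmin_le_cond; apply/injectiveP.
Qed.

End PairDistance.

Lemma card_edges (d : nat) (G : sgraph) : max_degree d G -> (#|edges G| <= #|G| * d)%N.
Proof.
move=> dG; have sub : edges G \subset
    (\bigcup_(x in G) (fun y => [set x; y]) @: nbr G x)%SET.
  apply/subsetP => e; rewrite inE => /existsP[x /existsP[y /andP[xy /eqP ->]]].
  by apply/bigcupP; exists x => //; apply: imset_f; rewrite inE.
apply: leq_trans (subset_leq_card sub) _.
apply: leq_trans (leq_card_bigcup _ _) _; rewrite -sum_nat_const.
by apply: leq_sum => x _; apply: leq_trans (leq_imset_card _ _) (dG x).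
Qed.

Lemma hyperfinite_pieces (R : realType) (d : nat) (G : nat -> sgraph) (e : R) :
  (forall n, max_degree d (G n)) ->
  hyperfinite R (fun H => exists n, G n = H) -> 0 < e ->
  exists K, forall n, exists2 C, @pieces (G n) K C &
    #|touching C|%:R <= e * #|G n|%:R.
Proof.
move=> dG hyp e0.
(* The 2 is for the ends of a removed edge, [d.+1] for the number of edges per vertex. *)
have e'0 : 0 < e / (2 * d.+1%:R) by rewrite divr_gt0 // mulr_gt0.
have [K hK] := hyp _ e'0; exists K => n.
have [F [FE Fs cF]] := hK _ (ex_intro _ n erefl).
have [C pC tC] := pieces_of_edge_cut FE cF; exists C => //.
apply: le_trans (_ : 2 * #|F|%:R <= _); first by rewrite -natrM ler_nat.
have := card_edges (@dG n); rewrite -(ler_nat R) natrM => cE.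
have n0 : 0 <= #|G n|%:R :> R by rewrite ler0n.
have d0 : 0 < d.+1%:R :> R by rewrite ltr0n.
have cE' : #|edges (G n)|%:R <= #|G n|%:R * d.+1%:R :> R.
  by apply: le_trans cE _; rewrite ler_wpM2l // ler_nat.
have := ler_wpM2l (ltW e'0) cE'.
have -> : e / (2 * d.+1%:R) * (#|G n|%:R * d.+1%:R) = e * #|G n|%:R / 2.
  by field; rewrite nat1r pnatr_eq0.
by move: Fs; set x := _ * #|edges _|%:R => Fs h; lra.
Qed.

(** Consecutive terms are the two radii in [drift], with [L] bounding the large pieces; the start
    [K.+1] leaves room for the small pieces and their neighbours. *)
Fixpoint radius_seq (K L j : nat) : nat :=
  if j is j'.+1 then radius_seq K L j' + L + L else K.+1.

Lemma radius_seq_gt K L j : (K < radius_seq K L j)%N.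
Proof. by elim: j => //= j IH; rewrite -addnA; apply: leq_trans IH (leq_addr _ _). Qed.

Lemma leq_radius_seq K L i j : (i <= j)%N -> (radius_seq K L i <= radius_seq K L j)%N.
Proof.
elim: j => [|j IH]; first by rewrite leqn0 => /eqP ->.
rewrite leq_eqVlt => /orP[/eqP -> //|/IH h] /=.
by apply: leq_trans h _; rewrite -addnA leq_addr.
Qed.

Theorem theorem3p1 (R : realType) (d : nat) (G : nat -> sgraph)
    (Gdeg : forall n, max_degree d (G n))
    (Gweak : weakly_convergent R d G)
    (Ghyp : hyperfinite R (fun H => exists n, G n = H)) :
  strongly_convergent R G.
Proof.
(* The strict inequality in hyperfiniteness, with bound 1, forces an edge in every graph, so none is
   empty. *)
have G0 n : (0 < #|G n|)%N.
  have [K hK] := Ghyp 1 ltr01; have [F [_ + _]] := hK _ (ex_intro _ n erefl).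
  rewrite mul1r ltr_nat => /(leq_ltn_trans (leq0n _)) E0.
  by have := leq_trans E0 (card_edges (@Gdeg n)); rewrite muln_gt0 => /andP[].
move=> eps eps0.
(* Each of the three terms of [delta_rho_le] gets [eps / 4]. The large pieces are cut finer by
   [d.+1 ^ K], the factor lost in [card_shallow]; in the last term, [beta] and [eta] contribute
   [eps / 8] each. *)
have [|K hK] := hyperfinite_pieces (e := eps / 4) Gdeg Ghyp; first by lra.
have DK0 : 0 < (d.+1 ^ K)%:R :> R by rewrite ltr0n expn_gt0.
have [|L hL] := hyperfinite_pieces (e := eps / 4 / (d.+1 ^ K)%:R) Gdeg Ghyp.
  by rewrite divr_gt0 //; lra.
have DL0 : 0 < (d.+1 ^ L)%:R :> R by rewrite ltr0n expn_gt0.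
have c0 : 0 < #|gcode K|%:R :> R.
  by rewrite ltr0n; apply/card_gt0P; exists (set0, set0, set0).
have L0 : 0 <= L%:R :> R by rewrite ler0n.
pose eta : R := eps / (16 * (#|gcode K|%:R * (d.+1 ^ L)%:R)).
have eta0 : 0 < eta by rewrite divr_gt0 // !mulr_gt0.
pose beta : R := eps / (8 * (#|gcode K|%:R * (1 + 2 * L%:R))).
have L1 : 0 < 1 + 2 * L%:R :> R by lra.
have beta0 : 0 < beta by rewrite divr_gt0 // !mulr_gt0.
pose J := Num.bound (eta ^+ 2)^-1.
have etaJ : 1 <= eta ^+ 2 * J%:R.
  have e20 : 0 < eta ^+ 2 by rewrite exprn_gt0.
  rewrite mulrC -ler_pdivrMr // mul1r ltW // archi_boundP // invr_ge0 ltW //.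
(* The index [j] will depend on [G m], but [J] depends on [eta] only; controlling all radii up to
   [radius_seq K L J] lets [N] be fixed beforehand. *)
have [N hN] := discrepancy_small Gdeg Gweak (radius_seq K L J).+1 G0 beta0.
exists N => m n Nm Nn.
have [C pC tC] := hK m; have [Q pQ tQ] := hL n.
have [j jJ hj] := refining_averages_stabilize (piece_code K C)
  (k := fun j => ball_type d (radius_seq K L j) (G := G m)) (fun j v w =>
   ball_type_le (@Gdeg m) (@Gdeg m) (leq_trans (leq_addr L _) (leq_addr L _))) eta0 etaJ.
have /card_gt0P[g0 _] := G0 m.
have rJ : (radius_seq K L j + L <= radius_seq K L J)%N.
  by apply: leq_trans (leq_radius_seq K L jJ); rewrite /= leq_addr.
have dr1 : (radius_seq K L j < (radius_seq K L J).+1)%N.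
  by rewrite ltnS; apply: leq_trans rJ; rewrite leq_addr.
have le := delta_rho_le (@Gdeg m) (@Gdeg n) pC pQ (radius_seq_gt K L j) g0
  (ltW beta0) (ltW eta0) (hN m n Nm Nn _ dr1) (hN m n Nm Nn _ rJ) hj (G0 n).
apply: le_lt_trans le _.
have m0 : 0 < #|G m|%:R :> R by rewrite ltr0n.
have n0 : 0 < #|G n|%:R :> R by rewrite ltr0n.
have h1 : #|touching C|%:R / #|G m|%:R <= eps / 4 by rewrite ler_pdivrMr.
have h2 : (#|touching Q| * d.+1 ^ K)%N%:R / #|G n|%:R <= eps / 4.
  rewrite ler_pdivrMr // natrM -ler_pdivlMr //.
  by rewrite mulrAC.
have h3 : #|gcode K|%:R * (beta + 2 * L%:R * beta + 2 * (d.+1 ^ L)%:R * eta) = eps / 4.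
  by rewrite /beta /eta; field; rewrite !lt0r_neq0.
by rewrite h3; lra.
Qed.
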